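(* Let $k\ge 2$ be an even integer, let $\mathbb{A}$ be the Albert algebra of $3\times 3$ Hermitian matrices over the octonions $\mathbb{O}$, and let $\operatorname{Tr}\colon \mathbb{A}\to\mathbb{R}$ be the trace. Let $X=\sum_{i=1}^{8}A^{i}e_i$ be a $3\times 3$ Hermitian matrix of variables over $\mathbb{O}$ (each $A^i$ a $3\times3$ matrix of real variables, $A^1$ symmetric and $A^i$ antisymmetric for $i>1$). Then $$\langle \operatorname{Tr} X^{k}\rangle_{\mathbb{A}} = 2^{-k/2}\sum_{\pi}\sum_{f}\Omega(\pi,f)\,3^{N(\pi)},$$ where the first sum is over all oriented gluings $\pi$ of the edges of the marked $k$-gon $\Pi_k^{*}$, and the second sum is over all functions $f$ from the edges of $\Pi_k^*$ to the set of octonion units $U=\{e_1,\dots,e_8\}$ that are compatible with $\pi$.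
   Context: **Octonions.** $\mathbb{O}$ is the real octonion algebra with basis $U=\{e_1,\dots,e_8\}$, $e_1=1$, $e_i^2=-1$ for $i>1$, $e_ie_j=-e_je_i$ for distinct $i,j>1$. The products of distinct imaginary units are given by an oriented Fano plane: for each oriented line $(a,b,c)$ one has $e_ae_b=e_c$, $e_be_c=e_a$, $e_ce_a=e_b$. The oriented lines are $(2,3,4),(2,5,6),(2,8,7),(3,5,7),(3,6,8),(4,5,8),(4,7,6)$. The unit $e_1$ is called real; $e_2,\dots,e_8$ are called imaginary. Conjugation fixes $e_1$ and negates $e_2,\dots,e_8$. A product of units is, up to sign, a unit independent of bracketing, so ''the product is real'' (i.e. equal to $\pm1$) does not depend on the bracketing. **Albert algebra.** $\mathbb{A}$ is the $27$-dimensional real vector space of $3\times3$ Hermitian matrices over $\mathbb{O}$ with product $X\bullet Y=(XY+YX)/2$ ($XY$ the usual matrix product). Powers: $X^1=X$, $X^k=X\bullet X^{k-1}$ for $k>1$. $\operatorname{Tr}$ is the sum of the diagonal entries. For a polynomial function $h$ on $\mathbb{A}$, $\langle h\rangle_{\mathbb{A}}=\int_{\mathbb{A}}h(X)e^{-\operatorname{Tr}(X^2)/2}dX\Big/\int_{\mathbb{A}}e^{-\operatorname{Tr}(X^2)/2}dX$, with $dX$ Lebesgue measure. **Fully nested bracketings.** A bracketing of a word of length $k\ge2$ corresponds to a rooted (planar, full) binary tree with $k$ leaves. It is fully nested if exactly one vertex of the tree has both children leaves. For a word $w$ of length $k\geq 2$ in elements of an algebra, $[w]_{\mathrm{fn}}=2^{-(k-2)}\sum_P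 P(w)$, the sum over all fully nested bracketings $P$ of $w$, where $P(w)$ is the value of the product bracketed by $P$. **Gluings.** $\Pi_k^*$ is a polygon with $k$ sides in the plane with a distinguished vertex. Its edges $E_1,\dots,E_k$ are numbered counterclockwise, the first and last being adjacent to the distinguished vertex. An oriented gluing $\pi$ is a choice of orientation of each edge together with a partition of the set of edges into pairs; each edge is glued to its partner consistently with the orientations. A pair $E,E'$ is glued without a twist if the orientations of $E$ and $E'$ are opposite as one moves around the boundary of $\Pi_k^*$, and with a twist otherwise. Oriented gluings with the same pairs, and with the same pairs glued with a twist, are counted as one, so that each pairing gives $2^{k/2}$ oriented gluings. $N(\pi)$ is the number of equivalence classes of vertices of $\Pi_k^*$ under the gluing. **Compatibility.** $f\colon\{E_1,\dots,E_k\}\to U$ is compatible with $\pi$ if (i) the product $f(E_1)\cdots f(E_k)$ is real, and (ii) $f(E)=f(E')$ whenever $\pi$ pairs $E$ with $E'$. **Value.** $\Omega(\pi,f)=\alpha(\pi,f)\,[f(E_1)\cdots f(E_k)]_{\mathrm{fn}}\in\mathbb{Q}$, where $\alpha(\pi,f)=\prod\alpha(E,E')$ over all pairs $\{E,E'\}$ of $\pi$, with $\alpha(E,E')=1$ if $f(E)=f(E')=e_1$; $\alpha(E,E')=1$ if $f(E)=f(E')$ is imaginary and $E,E'$ are glued without a twist; and $\alpha(E,E')=-1$ if $f(E)=f(E')$ is imaginary and $E,E'$ are glued with a twist.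
   Formalization: The signs in α are interchanged: a pair carrying an imaginary unit gets −1 if glued without a twist and +1 if glued with a twist; with the rule as given, at k=2 the right side is −15 while ⟨Tr X²⟩ = 27. *)

(* Defs.v *)
From HB Require Import structures.
From mathcomp Require Import all_boot all_order all_algebra.
From mathcomp Require Import zify.

Set Implicit Arguments.
Unset Strict Implicit.
Unset Printing Implicit Defensive.

Import Order.TTheory GRing.Theory Num.Theory.

Local Open Scope ring_scope.

(** An octonion is the row of its coordinates in the basis e_1, ..., e_8; the
    unit e_a is indexed by the ordinal a - 1, so that [ord0] stands for
    e_1 = 1 and every other index for an imaginary unit. *)

Definition octonion (F : fieldType) : lmodType F := 'rV[F]_8.

Definition fano_lines : seq (nat * nat * nat) :=
  [:: (2, 3, 4); (2, 5, 6); (2, 8, 7); (3, 5, 7);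
      (3, 6, 8); (4, 5, 8); (4, 7, 6)]%N.

Definition on_oriented_line (a b c : nat) : bool :=
  [|| (a, b, c) \in fano_lines, (b, c, a) \in fano_lines
    | (c, a, b) \in fano_lines].

(** The coefficient of e_c in e_a e_b, for 1 <= a, b, c <= 8. *)
Definition oct_coef (a b c : nat) : int :=
  if a == 1%N then (b == c)%:R
  else if b == 1%N then (a == c)%:R
  else if a == b then - (c == 1%N)%:R
  else (on_oriented_line a b c)%:R - (on_oriented_line b a c)%:R.

Section Octonions.
Variable F : fieldType.
Implicit Types x y : octonion F.

Definition oct_mk (c : 'I_8 -> F) : octonion F := \row_i c i.

Definition oct_coord x (i : 'I_8) : F := (x : 'rV[F]_8) ord0 i.

Definition oct_unit (a : 'I_8) : octonion F := oct_mk (fun i => (i == a)%:R).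

Definition oct_mul x y : octonion F :=
  oct_mk (fun c => \sum_(a < 8) \sum_(b < 8)
    oct_coord x a * oct_coord y b * (oct_coef a.+1 b.+1 c.+1)%:~R).

Definition oct_conj x : octonion F :=
  oct_mk (fun i => if i == ord0 then oct_coord x i else - oct_coord x i).

Definition oct_re x : F := oct_coord x ord0.

Definition oct_is_real x : bool :=
  [forall i : 'I_8, (i != ord0) ==> (oct_coord x i == 0)].

Lemma oct_coordE c i : oct_coord (oct_mk c) i = c i.
Proof. by rewrite /oct_coord mxE. Qed.

Lemma octP x y : (forall i, oct_coord x i = oct_coord y i) -> x = y.
Proof. by move=> xy; apply/rowP => i; exact: xy. Qed.

Lemma oct_conjK : involutive oct_conj.
Proof.
by move=> x; apply: octP => i; rewrite !oct_coordE; case: eqP => // _; rewrite opprK.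
Qed.

Lemma oct_mul_unit a b :
  oct_mul (oct_unit a) (oct_unit b)
  = oct_mk (fun c => (oct_coef a.+1 b.+1 c.+1)%:~R).
Proof.
apply: octP => c; rewrite !oct_coordE (bigD1 a)//= [X in _ + X]big1 => [|i ia].
  rewrite addr0 (bigD1 b)//= [X in _ + X]big1 => [|j jb].
    by rewrite addr0 !oct_coordE !eqxx !mul1r.
  by rewrite !oct_coordE (negbTE jb) mulr0 mul0r.
by apply: big1 => j _; rewrite !oct_coordE (negbTE ia) !mul0r.
Qed.

Implicit Types X Y : 'M[octonion F]_3.

Definition oct_mulmx X Y : 'M[octonion F]_3 :=
  \matrix_(i, j) \sum_l oct_mul (X i l) (Y l j).

Definition hermitian X : Prop := forall i j, X j i = oct_conj (X i j).

Definition jordan X Y : 'M[octonion F]_3 :=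
  \matrix_(i, j) ((2%:R : F)^-1 *: (oct_mulmx X Y i j + oct_mulmx Y X i j)).

(** The power n >= 1 with X^n = jordan X X^(n-1); the value at n = 0 is junk. *)
Definition jpow X (n : nat) : 'M[octonion F]_3 := iter n.-1 (jordan X) X.

(** The diagonal entries of a Hermitian matrix are real octonions; the trace is
    read off as an element of F through the coordinate of e_1. *)
Definition albert_tr X : F := oct_re (\sum_i X i i).

(** Coordinates on the 27-dimensional space of Hermitian matrices: entries 0, 1, 2
    of [v] are the diagonal; the blocks of 8 entries starting at 3, 11 and 19
    are the octonions in positions (0,1), (0,2) and (1,2). Thus the matrix is
    \sum_i A^i e_i with A^1 symmetric, A^i antisymmetric for i > 1, and the
    coordinates are the entries of A^1 on and above the diagonal and those of
    A^i strictly above it. *)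
Definition albert_offdiag (v : 27.-tuple F) (p : nat) : octonion F :=
  oct_mk (fun l => v`_(3 + 8 * p + l)).

Definition albert_mx (v : 27.-tuple F) : 'M[octonion F]_3 :=
  \matrix_(i, j)
    if i == j then v`_i *: oct_unit ord0
    else if (i < j)%N then albert_offdiag v (i + j).-1
    else oct_conj (albert_offdiag v (i + j).-1).

End Octonions.

Lemma albert_mx_hermitian (F : fieldType) (v : 27.-tuple F) :
  hermitian (albert_mx v).
Proof.
move=> i j; rewrite !mxE (eq_sym j i) (addnC j i).
case: eqVneq => [->|nij].
  by apply: octP => l; rewrite !oct_coordE /oct_coord !mxE; case: eqP => // _; rewrite mulr0 oppr0.
case: ltngtP => [ij|ij|ij]; rewrite ?oct_conjK//.
by case/eqP: nij; apply: val_inj.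
Qed.

Lemma albert_mx_bij (F : numFieldType) (X : 'M[octonion F]_3) :
  hermitian X -> exists! v : 27.-tuple F, albert_mx v = X.
Proof.
move=> XH.
pose lo (p : nat) : 'I_3 := if p == 2 then 1 else 0.
pose hi (p : nat) : 'I_3 := if p == 0 then 1 else 2.
pose g (m : nat) : F := if (m < 3)%N then oct_re (X (inord m) (inord m))
  else oct_coord (X (lo ((m - 3) %/ 8)%N) (hi ((m - 3) %/ 8)%N)) (inord ((m - 3) %% 8)).
have gd (i : 'I_3) : g i = oct_re (X i i) by rewrite /g ltn_ord inord_val.
have go p (l : 'I_8) : g (3 + 8 * p + l)%N = oct_coord (X (lo p) (hi p)) l.
  rewrite /g; have -> : (3 + 8 * p + l < 3)%N = false by lia.
  rewrite -addnA addKn mulnC divnMDl// modnMDl divn_small ?addn0//.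
  by rewrite modn_small// inord_val.
have pE (i j : 'I_3) : (i < j)%N -> lo (i + j).-1 = i /\ hi (i + j).-1 = j.
  by case: i j => [[|[|[|i]]] hi0] [[|[|[|j]]] hj0] //= _; split; apply: val_inj.
have pb (i j : 'I_3) (l : 'I_8) : (i < j)%N -> (3 + 8 * (i + j).-1 + l < 27)%N.
  by case: i j l => [i hi0] [j hj0] [l hl] /=; lia.
exists [tuple of mkseq g 27]; split.
  have offE (i j : 'I_3) : (i < j)%N ->
      albert_offdiag [tuple of mkseq g 27] (i + j).-1 = X i j.
    move=> ij; apply: octP => l; rewrite oct_coordE nth_mkseq ?pb// go.
    by have [-> ->] := pE _ _ ij.
  apply/matrixP => i j; rewrite mxE; case: eqVneq => [<-|nij].
    apply: octP => l; rewrite nth_mkseq; last by rewrite (leq_trans (ltn_ord i)).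
    rewrite gd {1}/oct_coord !mxE; case: eqVneq => [->|l0]; first by rewrite mulr1.
    have := congr1 (fun x => oct_coord x l) (XH i i).
    rewrite /= oct_coordE (negbTE l0) mulr0 => /eqP.
    by rewrite -addr_eq0 -mulr2n mulrn_eq0 /= => /eqP.
  case: ltngtP => [ij|ij|ij]; first exact: offE.
    by rewrite addnC offE// XH.
  by case/eqP: nij; apply: val_inj.
move=> v vX; apply: eq_from_tnth => m; rewrite !(tnth_nth 0) nth_mkseq//.
rewrite /g; case: ifPn => [m3|].
  by rewrite -vX /oct_re /oct_coord !mxE eqxx !mxE eqxx mulr1 inordK.
rewrite -leqNgt => m3.
have m8 : ((m - 3) %/ 8 < 3)%N by rewrite ltn_divLR//; have := ltn_ord m; lia.
have [lh lhE] : (lo ((m - 3) %/ 8)%N < hi ((m - 3) %/ 8)%N)%N /\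
    (lo ((m - 3) %/ 8)%N + hi ((m - 3) %/ 8)%N).-1 = ((m - 3) %/ 8)%N.
  by move: m8; case: (_ %/ _)%N => [|[|[|]]].
rewrite -vX /oct_coord !mxE -(inj_eq val_inj) ltn_eqF// lh lhE !mxE inordK ?ltn_mod//.
by rewrite mulnC -addnA -divn_eq subnKC.
Qed.

Inductive btree : Type := Leaf | Node of btree & btree.

Lemma btree_comparable : comparable btree.
Proof. by rewrite /comparable /decidable; decide equality. Qed.

HB.instance Definition _ :=
  hasDecEq.Build btree (fun s t => @compareP _ btree_comparable s t).

Fixpoint leaves (t : btree) : nat :=
  if t is Node l r then (leaves l + leaves r)%N else 1%N.

Fixpoint cherries (t : btree) : nat :=
  match t with
  | Leaf => 0
  | Node Leaf Leaf => 1
  | Node l r => cherries l + cherries r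
  end%N.

Definition fully_nested (t : btree) : bool := cherries t == 1%N.

Fixpoint bracketings_rec (fuel k : nat) : seq btree :=
  if fuel is m.+1 then
    if k == 1%N then [:: Leaf]
    else flatten [seq [seq Node l r | l <- bracketings_rec m i,
                                      r <- bracketings_rec m (k - i)]
                 | i <- iota 1 k.-1]
  else [::].

(** All bracketings of a word of length k, each listed once: see
    [mem_bracketings] and [uniq_bracketings]. *)
Definition bracketings (k : nat) : seq btree := bracketings_rec k k.

Lemma leaves_gt0 t : (0 < leaves t)%N.
Proof. by elim: t => //= l hl r hr; rewrite addn_gt0 hl. Qed.

Lemma mem_bracketings_rec m k t :
  (k <= m)%N -> (t \in bracketings_rec m k) = (leaves t == k).
Proof.
elim: m k t => [|m IHm] k t; first by rewrite leqn0 => /eqP->; rewrite /= gtn_eqF ?leaves_gt0.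
move=> km /=; case: ifPn => [/eqP->|k1].
  rewrite inE; apply/eqP/eqP => [->//|]; case: t => //= l r.
  by have := leaves_gt0 l; have := leaves_gt0 r; lia.
apply/flatten_mapP/eqP => [[i]|].
  rewrite mem_iota => /andP[i0 ik] /allpairsP[[l r]] /= [hl hr ->] /=.
  by move: hl hr; rewrite !IHm; [move=> /eqP-> /eqP->; lia|lia|lia].
case: t => [|l r] /= h; first by rewrite -h in k1.
have l0 := leaves_gt0 l; have r0 := leaves_gt0 r.
exists (leaves l); first by rewrite mem_iota; lia.
apply/allpairsP; exists (l, r); split=> //=; rewrite IHm; try lia.
Qed.

Lemma mem_bracketings k t : (t \in bracketings k) = (leaves t == k).
Proof. exact: mem_bracketings_rec. Qed.

Lemma uniq_bracketings_rec m k : (k <= m)%N -> uniq (bracketings_rec m k).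
Proof.
elim: m k => [//|m IHm] k km /=; case: ifPn => // k1.
have : all (fun i => 0 < i < k)%N (iota 1 k.-1).
  by apply/allP => i; rewrite mem_iota; lia.
elim: (iota 1 k.-1) (iota_uniq 1 k.-1) => //= i s IHs /andP[nis us] /andP[ik sk].
rewrite cat_uniq IHs// andbT; apply/andP; split.
  apply: allpairs_uniq; [by apply: IHm; lia|by apply: IHm; lia|].
  by move=> [l r] [l' r'] _ _ [-> ->].
apply/hasPn => t /flatten_mapP[j js /allpairsP[[l r]] [/= hl hr ->]].
apply/negP => /allpairsP[[l' r']] [/= hl' hr' [? ?]]; subst l' r'.
have jk := allP sk _ js.
move: hl hl'; rewrite !mem_bracketings_rec; [|lia|lia] => /eqP-> /eqP ji.
by rewrite -ji js in nis.
Qed.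

Lemma uniq_bracketings k : uniq (bracketings k).
Proof. exact: uniq_bracketings_rec. Qed.

(** The value of the word [w], of length [leaves t], bracketed by [t]. *)
Fixpoint bracket_value (A : Type) (x0 : A) (mul : A -> A -> A) (t : btree)
    (w : seq A) : A :=
  if t is Node l r then
    mul (bracket_value x0 mul l (take (leaves l) w))
        (bracket_value x0 mul r (drop (leaves l) w))
  else head x0 w.

Definition fn_bracket (F : fieldType) (A : lmodType F) (mul : A -> A -> A)
    (w : seq A) : A :=
  (2%:R ^- (size w - 2) : F) *:
    \sum_(t <- bracketings (size w) | fully_nested t)
      bracket_value 0 mul t w.

(** The edge E_(i+1) of the k-gon is indexed by i : 'I_k; traversed
    counterclockwise it goes from the vertex i to the vertex [ordS i], the
    vertex 0 being the distinguished one. *)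
Section Gluings.
Variable k : nat.

Definition pairing := {set {set 'I_k}}.

Definition is_pairing (P : pairing) : bool :=
  partition P [set: 'I_k] && [forall B in P, #|B| == 2].

(** An edge is oriented counterclockwise when [o] holds. *)
Definition orientation := {ffun 'I_k -> bool}.

Definition edge_tail (o : orientation) (i : 'I_k) : 'I_k :=
  if o i then i else ordS i.
Definition edge_head (o : orientation) (i : 'I_k) : 'I_k :=
  if o i then ordS i else i.

(** The pairs glued with a twist: the two orientations agree as one moves
    around the boundary. *)
Definition twisted_pairs (o : orientation) (P : pairing) : {set {set 'I_k}} :=
  [set B in P | [exists i in B, exists j in B, (i != j) && (o i == o j)]].

(** A gluing is recorded by its pairs and its pairs glued with a twist, so that
    the image set below counts as one the orientations with the same twisted
    pairs. *)
Definition gluing := ({set {set 'I_k}} * {set {set 'I_k}})%type.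

Definition oriented_gluings : {set gluing} :=
  [set (P, twisted_pairs o P)
     | P in [set Q | is_pairing Q], o in [set: orientation]].

Definition glued_vertices (pi : gluing) : rel 'I_k := fun v w =>
  [exists i, exists j, [&& i != j, [set i; j] \in pi.1 &
    if [set i; j] \in pi.2
    then (v == i) && (w == j) || (v == ordS i) && (w == ordS j)
    else (v == i) && (w == ordS j) || (v == ordS i) && (w == j)]].

Definition gluing_N (pi : gluing) : nat :=
  #|equivalence_partition (connect (glued_vertices pi)) [set: 'I_k]|.

(** The vertices are identified consistently with the orientations: tail with
    tail and head with head. *)
Lemma glued_vertices_orientation (o : orientation) (P : pairing) v w :
  glued_vertices (P, twisted_pairs o P) v w
  = [exists i, exists j, [&& i != j, [set i; j] \in P &
      (v == edge_tail o i) && (w == edge_tail o j)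
      || (v == edge_head o i) && (w == edge_head o j)]].
Proof.
apply: eq_existsb => i; apply: eq_existsb => j /=.
have [//|nij] := eqVneq i j; case: (boolP (_ \in P)) => //= ijP.
rewrite inE ijP /edge_tail /edge_head /=.
have -> : [exists i0 in [set i; j], exists j0 in [set i; j],
            (i0 != j0) && (o i0 == o j0)] = (o i == o j).
  apply/idP/idP => [/exists_inP[a] |oij].
    rewrite !inE => ha /exists_inP[b]; rewrite !inE => hb.
    case/orP: ha => /eqP->; case/orP: hb => /eqP->; rewrite ?eqxx//.
      by case/andP.
    by case/andP => _; rewrite eq_sym.
  apply/exists_inP; exists i; first by rewrite !inE eqxx.
  by apply/exists_inP; exists j; rewrite ?nij// !inE eqxx orbT.
by case: (o i); case: (o j) => //=; rewrite orbC.
Qed.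

Lemma glued_vertices_sym (pi : gluing) : symmetric (glued_vertices pi).
Proof.
move=> v w; apply/existsP/existsP => -[i /existsP[j /and3P[nij ijP h]]];
  exists j; apply/existsP; exists i; rewrite eq_sym nij setUC ijP /=;
  move: h; case: ifP => _ /orP[]/andP[-> ->]; rewrite ?orbT//.
Qed.

(** Every set of twisted pairs occurs, so that a pairing gives 2^(k/2) oriented
    gluings. *)
Lemma oriented_gluingsE (pi : gluing) :
  (pi \in oriented_gluings) = is_pairing pi.1 && (pi.2 \subset pi.1).
Proof.
case: pi => P T /=; apply/imset2P/andP => [[Q o]|[Ppair TP]].
  by rewrite inE => Qpair _ [-> ->]; split=> //; apply/subsetP => B; rewrite inE => /andP[].
have /andP[/and3P[/eqP covP tiP _] /forall_inP card2] := Ppair.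
pose o : orientation :=
  [ffun i => (pblock P i \in T) || ([pick x in pblock P i] == Some i)].
exists P o; rewrite ?inE//; congr pair; apply/setP => B; rewrite inE.
have [BP|BP] /= := boolP (B \in P); last first.
  by apply/negbTE/negP => /(subsetP TP); rewrite (negbTE BP).
have oB i : i \in B -> o i = (B \in T) || ([pick x in B] == Some i).
  by move=> iB; rewrite ffunE (def_pblock tiP BP iB).
have /cards2P[a [b [nab BE]]] := card2 _ BP.
apply/idP/exists_inP => [BT|[i iB /exists_inP[j jB /andP[nij]]]].
  have aB : a \in B by rewrite BE !inE eqxx.
  have bB : b \in B by rewrite BE !inE eqxx orbT.
  by exists a => //; apply/exists_inP; exists b; rewrite // nab !oB// BT.
rewrite !oB//; case: (B \in T) => //=; case: pickP => [x xB|/(_ i)]; last by rewrite iB.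
move: nij iB jB xB; rewrite BE !inE => nij.
rewrite !(inj_eq Some_inj).
by case/orP => /eqP ?; case/orP => /eqP ?; case/orP => /eqP ?; subst;
  move: nij nab; rewrite ?eqxx //= => nij nab; move: nij;
  rewrite ?(negbTE nab) ?[b == a]eq_sym ?(negbTE nab) ?eqxx.
Qed.

Definition unit_word (F : fieldType) (f : {ffun 'I_k -> 'I_8}) :
    seq (octonion F) :=
  [seq oct_unit F (f i) | i <- enum 'I_k].

(** Whether the product of the units f(E_1), ..., f(E_k) is real does not depend
    on the bracketing; the left-nested one is used. *)
Definition compatible (pi : gluing) (f : {ffun 'I_k -> 'I_8}) : bool :=
  oct_is_real (foldl (@oct_mul rat) (oct_unit rat ord0) (unit_word rat f))
  && [forall B in pi.1, forall i in B, forall j in B, f i == f j].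

(** For a > 1 the matrix A^a is antisymmetric, whence
    <A^a_ij A^a_lm> = (d_il d_jm - d_im d_jl) / 2, d being the Kronecker delta;
    the first term corresponds to gluing the edges ij and lm with a twist, the
    second one to gluing them without. So a pair
    carrying an imaginary unit has sign 1 if it is twisted and -1 otherwise;
    this corrects the rule with these two signs exchanged, for which the
    right-hand side of the trace formula at k = 2 is -15, while
    <Tr X^2> = 27. *)
Definition gluing_alpha (pi : gluing) (f : {ffun 'I_k -> 'I_8}) : rat :=
  \prod_(B in pi.1)
    (if [forall i in B, f i == ord0] then 1
     else if B \in pi.2 then 1 else -1).

(** For compatible f the octonion [fn_bracket _ _] is real, and is read off
    through its coordinate of e_1. *)
Definition gluing_Omega (pi : gluing) (f : {ffun 'I_k -> 'I_8}) : rat :=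
  gluing_alpha pi f * oct_re (fn_bracket (@oct_mul rat) (unit_word rat f)).

End Gluings.

From mathcomp Require Import all_classical all_reals all_analysis.
Import numFieldNormedType.Exports.

Local Open Scope classical_set_scope.

Section LebesgueTuple.
Variable R : realType.
Let T : measurableType _ := measurableTypeR R.

Definition cons_pair (n : nat) (p : T * n.-tuple T) : n.+1.-tuple T :=
  [tuple of p.1 :: p.2].

Definition uncons (n : nat) (t : n.+1.-tuple T) : T * n.-tuple T :=
  (thead t, [tuple of behead t]).

Lemma cons_pairK n : cancel (@cons_pair n) (@uncons n).
Proof.
move=> [x t]; rewrite /uncons /cons_pair /= theadE; congr pair.
exact: val_inj.
Qed.

Lemma unconsK n : cancel (@uncons n) (@cons_pair n).
Proof. by move=> t; rewrite /uncons /cons_pair /= -tuple_eta. Qed.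

Lemma measurable_cons_pair n : measurable_fun setT (@cons_pair n).
Proof.
by apply: measurable_cons; [exact: measurable_fst|exact: measurable_snd].
Qed.

Lemma measurable_uncons n : measurable_fun setT (@uncons n).
Proof.
apply/measurable_fun_pairP; split.
  exact: measurable_tnth.
exact: measurable_behead.
Qed.

Section Step.
Variables (n : nat) (mu : {sigma_finite_measure set (n.-tuple T) -> \bar R}).
Local Open Scope ereal_scope.

Definition lebesgue_cons : set (n.+1.-tuple T) -> \bar R :=
  pushforward (@lebesgue_measure R \x mu) (@cons_pair n).
Let l0 : lebesgue_cons set0 = 0.
Proof. by rewrite /lebesgue_cons /pushforward preimage_set0 measure0. Qed.
Let lge0 A : 0 <= lebesgue_cons A.
Proof. by rewrite /lebesgue_cons /pushforward; exact: measure_ge0. Qed.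
Let ladd : semi_sigma_additive lebesgue_cons.
Proof.
move=> F mF tF mUF; rewrite /lebesgue_cons /pushforward preimage_bigcup.
apply: measure_semi_sigma_additive.
- by move=> i; rewrite -[X in measurable X]setTI; exact: measurable_cons_pair.
- apply/trivIsetP => /= i j _ _ ij; rewrite -preimage_setI.
  by move/trivIsetP : tF => /(_ _ _ _ _ ij) ->//; rewrite preimage_set0.
- by rewrite -preimage_bigcup -[X in measurable X]setTI; exact: measurable_cons_pair.
Qed.
HB.instance Definition _ := isMeasure.Build _ _ _ lebesgue_cons l0 lge0 ladd.

Let lsf : sigma_finite setT lebesgue_cons.
Proof.
have /sigma_finiteP[F [TF ndF Foo]] := sigma_finiteT (@lebesgue_measure R).
have /sigma_finiteP[G [TG ndG Goo]] := sigma_finiteT mu.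
exists (fun i => @uncons n @^-1` (F i `*` G i)).
  rewrite -preimage_bigcup (_ : \bigcup_i _ = setT) ?preimage_setT//.
  rewrite -setXTT TF TG predeqE => -[x y]; split.
    by move=> [i _ []/= ? ?]; split; exists i.
  move=> [/= [i _ Fnx] [k _ Gky]]; exists (maxn i k) => //; split.
  - by move: x Fnx; exact/subsetPset/ndF/leq_maxl.
  - by move: y Gky; exact/subsetPset/ndG/leq_maxr.
move=> k; have [mF Fk] := Foo k; have [mG Gk] := Goo k; split.
  rewrite -[X in measurable X]setTI; apply: measurable_uncons => //.
  exact: measurableX.
rewrite /lebesgue_cons /pushforward -comp_preimage.
rewrite (_ : _ \o _ = id); last by apply/funext => x; exact: cons_pairK.
by rewrite preimage_id product_measure1E// lte_mul_pinfty// ge0_fin_numE.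
Qed.
HB.instance Definition _ := Measure_isSigmaFinite.Build _ _ _ lebesgue_cons lsf.

Lemma lebesgue_consE (A : set T) (B : n.+1.-tuple T -> Prop) (C : set (n.-tuple T)) :
  measurable A -> measurable C ->
  (forall t, B t <-> A (thead t) /\ C [tuple of behead t]) ->
  lebesgue_cons B = lebesgue_measure A * mu C.
Proof.
move=> mA mC BAC; rewrite /lebesgue_cons /pushforward -product_measure1E//.
congr (_ _); apply/seteqP; split => -[x t] /=.
  by move/BAC; rewrite theadE => -[Ax Ct]; split => //=; congr (C _): Ct; apply: val_inj.
move=> [/= Ax Ct]; apply/BAC; rewrite theadE; split => //.
by congr (C _): Ct; apply: val_inj.
Qed.

End Step.

(** Lebesgue measure on R^n: the n-fold product of [lebesgue_measure], see
    [lebesgue_tuple_box]. *)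
Fixpoint lebesgue_tuple (n : nat) : {sigma_finite_measure set (n.-tuple T) -> \bar R} :=
  match n with
  | 0 => \d_([tuple] : 0.-tuple T)
  | m.+1 => lebesgue_cons (lebesgue_tuple m)
  end.

Definition tuple_box n (A : 'I_n -> set T) : set (n.-tuple T) :=
  [set t | forall i, A i (tnth t i)].

Lemma measurable_tuple_box n (A : 'I_n -> set T) :
  (forall i, measurable (A i)) -> measurable (tuple_box A).
Proof.
move=> mA; have -> : tuple_box A = \bigcap_(i in [set: 'I_n]) (fun t : n.-tuple T => tnth t i) @^-1` A i.
  by apply/seteqP; split => t /= h i; [move=> _|]; exact: h.
apply: fin_bigcap_measurable => // i _.
by rewrite -[X in measurable X]setTI; exact: measurable_tnth.
Qed.

Lemma lebesgue_tuple_box n (A : 'I_n -> set T) :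
  (forall i, measurable (A i)) ->
  lebesgue_tuple n (tuple_box A) = (\prod_(i < n) lebesgue_measure (A i))%E.
Proof.
elim: n A => [|n IHn] A mA.
  rewrite big_ord0 /= diracE mem_set//; by case.
rewrite big_ord_recl /= -IHn => [|i]; last exact: mA.
apply: lebesgue_consE => //; first exact: measurable_tuple_box.
move=> t; split=> [h|[h0 hS] i].
  split; first exact: h.
  by move=> i; rewrite tnth_behead -[inord _](_ : lift ord0 i = _) ?h//; apply: val_inj; rewrite /= inordK ?ltnS.
case: (unliftP ord0 i) => [j ->|->//].
by have := hS j; rewrite tnth_behead (_ : inord _ = lift ord0 j)//; apply: val_inj; rewrite /= inordK ?ltnS.
Qed.

End LebesgueTuple.

(** The mean of h for the Gaussian weight on the space of Hermitian matrices.
    Lebesgue measure is taken in the coordinates of [albert_mx]; any other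
    normalization cancels in the quotient. *)
Definition albert_mean (R : realType) (h : 'M[octonion R]_3 -> R) : R :=
  let weight X := expR (- (albert_tr (jpow X 2) / 2%:R)) in
  (\int[lebesgue_tuple R 27]_v (h (albert_mx v) * weight (albert_mx v)))
  / \int[lebesgue_tuple R 27]_v weight (albert_mx v).

(* Main.v *)
(** Expanding [X^k] over index paths and octonion units, [Tr X^k] is the sum,
    over [g : edges -> units] and [p : vertices -> {0, 1, 2}], of
    [Re [g(E_1) ... g(E_k)]_fn] times the product of the coordinates
    [A^(g x)] at [(p x, p (x + 1))]; fully nested bracketings are exactly those
    produced by [X^k = (X X^(k-1) + X^(k-1) X) / 2]. For the Gaussian weight the
    27 coordinates are independent, and integration by parts in one variable
    gives Wick's formula: the mean of the product is a sum over pairings of the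
    edges of products of covariances. Each covariance is half a sum of a
    twisted and a straight identification of the end points, so that expanding
    produces the twisted subset of the pairing, and summing over [p] counts the
    3-colourings of the glued vertices, of which there are [3^N]. When the
    product of units is not real, the (Z/2)^3-grading of the octonions makes
    every bracketing imaginary, so its term vanishes. *)

Require Import Defs.
From mathcomp Require Import all_boot all_order all_algebra.
From mathcomp Require Import all_classical all_reals all_analysis.
From mathcomp Require Import measurable_realfun zify ring.

Set Implicit Arguments.
Unset Strict Implicit.
Unset Printing Implicit Defensive.

Import Order.TTheory GRing.Theory Num.Theory.
Import numFieldNormedType.Exports.

Local Open Scope ring_scope.

(** * Gaussian moments on the line *)

Section GaussianMoments.
Variable R : realType.
Local Open Scope classical_set_scope.
Notation mu := (@lebesgue_measure R).

(** The fundamental theorem of calculus evaluates the integral of [f] over a symmetric interval by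
    boundary values of [F]; dominated convergence with bound [|f|] then passes to the whole line. *)
Lemma Rintegral_derivative_eq0 (F f : R -> R) :
  (forall x : R, is_derive x (1 : R) F (f x)) -> continuous f ->
  mu.-integrable setT (EFin \o f) ->
  (fun n : nat => F n%:R) @ \oo --> (0 : R) ->
  (fun n : nat => F (- n%:R)) @ \oo --> (0 : R) ->
  \int[mu]_x f x = 0.
Proof.
move=> Ff cf intf F0 FN0.
have cF : continuous F.
  by move=> x; apply: differentiable_continuous; apply/derivable1_diffP/ex_derive.
(* The endpoints use [n.+1] because the fundamental theorem is applied to a nondegenerate
   interval. *)
pose D (n : nat) := `[- n.+1%:R, n.+1%:R]%classic : set (measurableTypeR R).
pose f' : measurableTypeR R -> \bar R := EFin \o f.
pose f_ (n : nat) : measurableTypeR R -> \bar R := f' \_ (D n).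
have mf : measurable_fun setT f' := measurable_int mu intf.
have mD n : measurable (D n) by exact: measurable_itv.
have mf_ n : measurable_fun setT (f_ n).
  apply: (measurable_restrictT f' (mD n)).1.
  exact: measurable_funTS mf.
have [|||_ _] := @dominated_convergence _ _ _ mu setT measurableT f_ f'
    (fun x => `|f' x|)%E mf_ mf.
- apply: aeW => x _; apply: cvg_near_cst; near=> n.
  rewrite /f_ patchE ifT// inE /D /= in_itv/= -ler_norml.
  apply: (@le_trans _ _ (Num.truncn `|x|).+1%:R); first by rewrite ltW// truncnS_gt.
  by rewrite ler_nat; near: n; exists (Num.truncn `|x|) => // m /=; rewrite ltnS.
- exact: integrable_abse.
- apply: aeW => x n _ /=; rewrite /f_ patchE; case: ifP => //.
  by move=> _; rewrite abse0 lee_fin.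
move=> lim1.
have E1 : (fun n => \int[mu]_x f_ n x)%E = (fun n => (F n.+1%:R - F (- n.+1%:R))%:E).
  apply/funext => n; rewrite -integral_mkcond (continuous_FTC2 (F := F)) ?EFinB//.
  - by rewrite gtrN.
  - exact: continuous_subspaceT.
  - split; first by move=> x _; exact: ex_derive.
      exact/cvg_at_right_filter/cF.
    exact/cvg_at_left_filter/cF.
  - by move=> x _; rewrite derive1E; exact: derive_val.
move: lim1; rewrite E1 => lim1.
have lim2 : (fun n => (F n.+1%:R - F (- n.+1%:R))%:E) @ \oo --> (0 : R)%:E.
  apply: cvg_EFin; first by near=> n.
  rewrite -[0 : R]subr0; apply: (@cvgB _ R^o).
    by move: F0; rewrite -(cvg_shiftS (fun n : nat => F n%:R)).
  by move: FN0; rewrite -(cvg_shiftS (fun n : nat => F (- n%:R))).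
by rewrite /Rintegral (cvg_unique _ lim1 lim2).
Unshelve. all: by end_near. Qed.

Definition gauss_weight (c x : R) : R := expR (- (c * x ^+ 2)).

(** With variance [1 / (2 * c)] the weight is a multiple of a normal density, from which it inherits
    integrability and a positive total mass. *)
Lemma gauss_weightE (c : R) : 0 < c ->
  exists2 a : R, 0 < a & forall x, gauss_weight c x = a * normal_pdf 0 (Num.sqrt (2 * c)^-1) x.
Proof.
move=> c0; set s := Num.sqrt _.
have s0 : s != 0 by rewrite gt_eqF// sqrtr_gt0 invr_gt0 mulr_gt0.
have p0 := normal_peak_gt0 s0.
exists (normal_peak s)^-1; first by rewrite invr_gt0.
move=> x; rewrite normal_pdfE// mulKf ?gt_eqF// /normal_fun /gauss_weight subr0.
rewrite sqr_sqrtr; last by rewrite invr_ge0 mulr_ge0 ?ltW.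
by congr expR; rewrite -mulr_natl; field; rewrite gt_eqF.
Qed.

Lemma integrable_gauss_weight (c : R) : 0 < c ->
  mu.-integrable setT (EFin \o gauss_weight c).
Proof.
move=> /gauss_weightE[a _ E].
have -> : EFin \o gauss_weight c = (fun x => a%:E * (normal_pdf 0 (Num.sqrt (2 * c)^-1) x)%:E)%E.
  by apply/funext => x /=; rewrite E.
exact/integrableZl/integrable_normal_pdf.
Qed.

Lemma Rintegral_gauss_weight_gt0 (c : R) : 0 < c ->
  0 < \int[mu]_x gauss_weight c x.
Proof.
move=> /gauss_weightE[a a0 E].
under eq_Rintegral do rewrite E.
rewrite RintegralZl//; last exact: integrable_normal_pdf.
by rewrite /Rintegral integral_normal_pdf mulr1.
Qed.

Lemma gauss_weight_ge0 c x : 0 <= gauss_weight c x.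
Proof. exact: expR_ge0. Qed.

(** For [|x| <= 1] the bound 1 suffices. For larger [|x|], [|x| ^+ n] is at most [x ^+ (2 * n.+1)],
    which the term of degree [n.+1] in the series of [expR (c * x ^+ 2)] controls. The constant adds
    the two bounds. *)
Lemma exprn_gauss_weight_bounded (c : R) n : 0 < c ->
  exists2 M : R, 0 < M & forall x, `|x| ^+ n * gauss_weight c x <= M.
Proof.
move=> c0; exists (1 + n.+1`!%:R / c ^+ n.+1).
  by rewrite addr_gt0// divr_gt0 ?exprn_gt0 ?ltr0n ?fact_gt0.
move=> x; set y := c * x ^+ 2.
have y0 : 0 <= y by rewrite mulr_ge0 ?sqr_ge0 ?ltW.
have Ey : y ^+ n.+1 / n.+1`!%:R <= expR y.
  by apply: le_trans (expR_ge1Dxn n y0); rewrite lerDr.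
rewrite /gauss_weight expRN ler_pdivrMr ?expR_gt0//.
have [x1|x1] := leP `|x| 1.
  apply: (@le_trans _ _ (1 * expR y)).
    rewrite mul1r (@le_trans _ _ 1)// ?exprn_ile1//.
    by rewrite -[leLHS]addr0 (le_trans _ (expR_ge1Dx _))// lerD2l.
  by rewrite ler_pM2r ?expR_gt0// lerDl divr_ge0// exprn_ge0// ltW.
apply: (@le_trans _ _ (n.+1`!%:R / c ^+ n.+1 * expR y)); last first.
  by rewrite ler_pM2r ?expR_gt0// lerDr.
rewrite -ler_pdivrMl; last by rewrite divr_gt0 ?exprn_gt0 ?ltr0n ?fact_gt0.
apply: le_trans Ey; rewrite /y exprMn -exprM invf_div.
rewrite mulrAC ler_pM2r ?invr_gt0 ?ltr0n ?fact_gt0// ler_pM2l ?exprn_gt0//.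
have -> : x ^+ (2 * n.+1) = `|x| ^+ (2 * n.+1) by rewrite !exprM real_normK ?num_real.
by apply: ler_weXn2l; [exact: ltW|lia].
Qed.

Definition gauss_mono c n (x : R) : R := x ^+ n * gauss_weight c x.

Lemma continuous_gauss_weight c : continuous (gauss_weight c).
Proof.
move=> x; apply: (cvg_comp (fun x => - (c * x ^+ 2)) expR); last exact: continuous_expR.
apply: (@cvgN _ R^o); apply: cvgM; first exact: cvg_cst.
exact: sqr_continuous.
Qed.

Lemma continuous_gauss_mono (c : R) n : continuous (gauss_mono c n).
Proof.
by move=> x; apply: cvgM; [exact: exprn_continuous|exact: continuous_gauss_weight].
Qed.

Lemma integrable_gauss_mono (c : R) n : 0 < c ->
  mu.-integrable setT (EFin \o gauss_mono c n).
Proof.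
move=> c0.
(* The weight is the square of the weight of parameter [c / 2]: one factor absorbs the power of [x],
   the other is the integrable majorant. *)
have c20 : 0 < c / 2 by rewrite divr_gt0.
have [M M0 HM] := exprn_gauss_weight_bounded n c20.
have mg : measurable_fun setT (gauss_mono c n).
  apply: continuous_measurable_fun; exact: continuous_gauss_mono.
apply: (@le_integrable _ _ R mu setT measurableT _
   (fun x => M%:E * (gauss_weight (c / 2) x)%:E)%E).
- exact/measurable_EFinP.
- move=> x _ /=; rewrite lee_fin [leRHS]ger0_norm; last first.
    by rewrite mulr_ge0 ?gauss_weight_ge0 ?ltW.
  rewrite /gauss_mono normrM normrX (ger0_norm (gauss_weight_ge0 _ _)).
  have -> : gauss_weight c x = gauss_weight (c / 2) x * gauss_weight (c / 2) x.
    by rewrite -expRD -opprD -mulrDl -splitr.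
  by rewrite mulrA ler_wpM2r ?gauss_weight_ge0.
- exact/integrableZl/integrable_gauss_weight.
Qed.

Lemma gauss_mono_norm c n (x : R) : `|gauss_mono c n (- x)| = `|gauss_mono c n x|.
Proof. by rewrite /gauss_mono !normrM !normrX normrN /gauss_weight sqrrN. Qed.

(** The bound in degree [n.+1] leaves a decay of [M / m] in degree [n]; the index is shifted to
    avoid division by zero. *)
Lemma cvg_gauss_mono (c : R) n : 0 < c ->
  (fun m : nat => `|gauss_mono c n m%:R|) @ \oo --> (0 : R).
Proof.
move=> c0; have [M M0 HM] := exprn_gauss_weight_bounded n.+1 c0.
rewrite -(cvg_shiftS (fun m : nat => `|gauss_mono c n m%:R|)).
apply: (@squeeze_cvgr _ _ _ _ (fun=> 0) (fun m : nat => M * m.+1%:R^-1)).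
- near=> m; rewrite normr_ge0/= ler_pdivlMr ?ltr0n//.
  rewrite -[X in _ * X](@ger0_norm _ m.+1%:R)// -normrM mulrC /gauss_mono mulrA -exprS.
  by rewrite normrM normrX (ger0_norm (gauss_weight_ge0 _ _)) HM.
- exact: cvg_cst.
- rewrite -[X in _ --> X](mulr0 M); apply: cvgM; first exact: cvg_cst.
  exact: cvg_harmonic.
Unshelve. all: by end_near. Qed.

Lemma is_derive_gauss_mono (c : R) n (x : R) :
  is_derive x (1 : R) (gauss_mono c n)
    (n%:R * gauss_mono c n.-1 x - 2 * c * gauss_mono c n.+1 x).
Proof.
have D1 : is_derive x (1 : R) (fun x : R => - (c * x ^+ 2)) (- (c * (x *+ 2))).
  apply: is_deriveN; apply: is_deriveZ => //.
  by apply: is_derive_eq; rewrite /GRing.scale/= mulr1.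
have D2 : is_derive x (1 : R) (gauss_weight c) (gauss_weight c x * - (c * (x *+ 2))).
  by apply: is_derive1_comp.
have D3 : is_derive x (1 : R) (fun x : R => x ^+ n) (n%:R * x ^+ n.-1).
  rewrite (_ : (fun x => x ^+ n) = (id : R -> R) ^+ n); last first.
    by apply/funext => y; rewrite exprfctE.
  rewrite (_ : _ * _ = (n%:R * (id x : R) ^+ n.-1) *: (1 : R)); last first.
    by rewrite /GRing.scale/= mulr1.
  exact: is_deriveX.
suff <- : x ^+ n *: (gauss_weight c x * - (c * (x *+ 2))) + gauss_weight c x *: (n%:R * x ^+ n.-1)
    = n%:R * gauss_mono c n.-1 x - 2 * c * gauss_mono c n.+1 x by exact: is_deriveM.
rewrite /GRing.scale/= /gauss_mono exprS.
by case: n {D3} => [|n] /=; rewrite ?exprS; ring.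
Qed.

(* The right-hand side minus the left-hand side is the integral of the derivative
   of [gauss_mono c n]. At n = 0 the junk index [n.-1] is multiplied by 0. *)
Lemma gauss_moment_rec (c : R) n : 0 < c ->
  2 * c * (\int[mu]_x gauss_mono c n.+1 x) = n%:R * \int[mu]_x gauss_mono c n.-1 x.
Proof.
move=> c0; apply/eqP; rewrite eq_sym -subr_eq0; apply/eqP.
have j (r : R) m : mu.-integrable setT (EFin \o (fun x => r * gauss_mono c m x)).
  have -> : EFin \o (fun x => r * gauss_mono c m x)
      = (fun x => r%:E * (gauss_mono c m x)%:E)%E by [].
  exact/integrableZl/integrable_gauss_mono.
rewrite -!RintegralZl//; try exact: integrable_gauss_mono.
rewrite -(RintegralB measurableT (j _ _) (j _ _)).
apply: (@Rintegral_derivative_eq0 (gauss_mono c n)).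
- exact: is_derive_gauss_mono.
- by move=> x; apply: (@cvgB _ R^o); apply: cvgM; do ?[exact: cvg_cst|exact: continuous_gauss_mono].
- exact: (integrableB measurableT (j _ _) (j _ _)).
- by apply: norm_cvg0; exact: cvg_gauss_mono.
- apply: norm_cvg0; under eq_fun do rewrite gauss_mono_norm.
  exact: cvg_gauss_mono.
Qed.

End GaussianMoments.

(** * Integration over tuples *)

Section ProductIntegrals.
Context {d1 d2 : measure_display} {T1 : measurableType d1} {T2 : measurableType d2}.
Context {R : realType}.
Variables (m1 : {sigma_finite_measure set T1 -> \bar R}).
Variables (m2 : {sigma_finite_measure set T2 -> \bar R}).
Variables (f : T1 -> R) (g : T2 -> R).
Hypotheses (intf : m1.-integrable setT (EFin \o f)) (intg : m2.-integrable setT (EFin \o g)).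
Local Open Scope ereal_scope.

Lemma integrable_prodM :
  (m1 \x m2).-integrable setT (fun z : T1 * T2 => (f z.1 * g z.2)%:E).
Proof.
have mf := measurable_int _ intf; have mg := measurable_int _ intg.
apply/integrable12ltyP.
  apply/measurable_EFinP; apply: measurable_funM.
    by apply: measurableT_comp => //; exact/measurable_EFinP.
  by apply: measurableT_comp => //; exact/measurable_EFinP.
under eq_integral => x _.
  under eq_integral => y _ do rewrite /= normrM EFinM.
  rewrite ge0_integralZl//=; last by apply/measurable_EFinP; apply: measurableT_comp => //; exact/measurable_EFinP.
  over.
rewrite ge0_integralZr//=; last 2 first.
- by apply/measurable_EFinP; apply: measurableT_comp => //; exact/measurable_EFinP.
- exact: integral_ge0.
case/integrableP : intf => _ f_fin; case/integrableP : intg => _ g_fin.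
by rewrite lte_mul_pinfty ?ge0_fin_numE// integral_ge0.
Qed.

Lemma integral_prodM :
  \int[m1 \x m2]_z (f z.1 * g z.2)%:E = \int[m1]_x (f x)%:E * \int[m2]_y (g y)%:E.
Proof.
rewrite -integral12_prod_meas1; last exact: integrable_prodM.
rewrite /fubini_F /=.
under eq_integral => x _.
  under eq_integral => y _ do rewrite EFinM.
  rewrite integralZl//; over.
rewrite /=.
have -> : \int[m2]_y (g y)%:E = (\int[m2]_y g y)%R%:E.
  by rewrite fineK//; exact: integrable_fin_num.
by rewrite integralZr.
Qed.

End ProductIntegrals.

Section TupleIntegrals.
Variable R : realType.
Notation mu := (@lebesgue_measure R).
Local Open Scope ereal_scope.

(** [cons_pair] presents the measure on [n.+1]-tuples as the image of a product measure, so Fubini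
    splits off the first coordinate. Integrability is proved along with the value because Fubini
    needs it for the remaining coordinates. *)
Lemma lebesgue_tuple_prod n (g : 'I_n -> R -> R) :
  (forall i, mu.-integrable setT (EFin \o g i)) ->
  (lebesgue_tuple R n).-integrable setT (fun t => (\prod_(i < n) g i (tnth t i))%:E) /\
  \int[lebesgue_tuple R n]_t (\prod_(i < n) g i (tnth t i))%:E
    = (\prod_(i < n) (\int[mu]_x g i x))%R%:E.
Proof.
elim: n g => [|n IHn] g intg.
  have E : (fun t : 0.-tuple (measurableTypeR R) => (\prod_(i < 0) g i (tnth t i))%:E)
      = cst (1%R%:E).
    by apply/funext => t; rewrite big_ord0.
  rewrite E; split.
    apply/integrableP; split; first exact: measurable_cst.
    by rewrite /= integral_dirac//= diracT mul1e normr1 ltry.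
  by rewrite /= integral_dirac//= diracT mul1e big_ord0.
have [int1 E1] := IHn (fun i => g (lift ord0 i)) (fun i => intg _).
pose f (t : n.+1.-tuple (measurableTypeR R)) := (\prod_(i < n.+1) g i (tnth t i))%:E.
have Ef : f \o @cons_pair R n =
    (fun z => (g ord0 z.1 * \prod_(i < n) g (lift ord0 i) (tnth z.2 i))%R%:E).
  apply/funext => -[x t]; rewrite /f /= big_ord_recl tnth0.
  by congr (_ * _)%:E; apply: eq_bigr => i _; rewrite tnthS.
have mg i : measurable_fun setT (g i : measurableTypeR R -> R).
  by apply/measurable_EFinP; exact: measurable_int (intg i).
have mf : measurable_fun [set: _] f.
  apply/measurable_EFinP; apply: measurable_prod => i _.
  by apply: measurableT_comp; [exact: mg|exact: measurable_tnth].
have intf : (mu \x lebesgue_tuple R n).-integrable setT (f \o @cons_pair R n).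
  by rewrite Ef; exact: (integrable_prodM (intg _) int1).
split.
  rewrite -/f. have H := (integrable_pushforward (@measurable_cons_pair R n) mf intf measurableT).
  exact: H.
transitivity (\int[pushforward (mu \x lebesgue_tuple R n) (@cons_pair R n)]_t f t) => //.
rewrite (integral_pushforward (@measurable_cons_pair R n) mf intf measurableT).
rewrite preimage_setT Ef.
rewrite (integral_prodM (intg ord0) int1) E1 big_ord_recl.
rewrite EFinM /Rintegral; congr (_ * _); rewrite fineK//.
exact: (integrable_fin_num measurableT (intg ord0)).
Qed.

End TupleIntegrals.

(** * Pairings and the Wick recursion *)

(* From here on [setT], [partition], [subsetP], ... are those of finite sets, not
   those of [classical_sets]. *)
From mathcomp Require Import fintype finset.

Section PairPartitions.
Variables (T : finType) (A : comPzRingType).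
Implicit Types (D B : {set T}) (P : {set {set T}}).

(** An arbitrary [D] is allowed because the Wick recursion removes the points of one pair; on the
    full set of edges this is [is_pairing]. *)
Definition pair_partition P D : bool :=
  partition P D && [forall B in P, #|B| == 2].

Lemma pair_partition0 P : pair_partition P set0 = (P == set0).
Proof.
rewrite /pair_partition partition_set0; case: eqP => [->|]//=.
by apply/forall_inP => B; rewrite inE.
Qed.

(** Together with [pair_partition_setU], this yields the bijection between the pairings of [D] that
    contain [B] and the pairings of [D :\: B]. *)
Lemma pair_partition_setD P D B : B \in P ->
  pair_partition P D -> pair_partition (P :\ B) (D :\: B).
Proof.
move=> BP /andP[partP /forall_inP card2].
have [_ tiP n0] := and3P partP; apply/andP; split.
  rewrite /partition -(cover_partition partP) trivIsetD// 2!inE (negbTE n0) andbF andbT.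
  by have := coverD1 tiP BP; rewrite /cover => ->.
by apply/forall_inP => C; rewrite inE => /andP[_]; exact: card2.
Qed.

Lemma pair_partition_setU P D B : B \subset D -> #|B| = 2 ->
  pair_partition P (D :\: B) -> pair_partition (B |: P) D /\ B \notin P.
Proof.
move=> BD B2 /andP[partP /forall_inP card2].
have B0 : B != set0 by rewrite -card_gt0 B2.
have [_ _ n0] := and3P partP.
have disj : [disjoint B & D :\: B].
  by rewrite -setI_eq0; apply/eqP/setP => z; rewrite !inE; case: (z \in B).
split; last first.
  apply/negP => BP; move: disj; rewrite -(cover_partition partP) => disj.
  have BP' : B \subset cover P by apply: (bigcup_max B).
  have := disjointWr BP' disj.
  by rewrite -setI_eq0 setIid (negbTE B0).
apply/andP; split.
  have := partitionU1 partP B0 disj.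
  suff -> : B :|: D :\: B = D by apply.
  by apply/setP => z; rewrite !inE; case: (boolP (z \in B)) => // /(subsetP BD) ->.
by apply/forall_inP => C; rewrite !inE => /predU1P[->|/card2//]; rewrite B2.
Qed.

(* Partitions of D into pairs are sorted according to the partner y of x. *)
Lemma pair_partition_rec (F : {set T} -> A) D x : x \in D ->
  \sum_(P | pair_partition P D) \prod_(B in P) F B
  = \sum_(y in D :\ x) F [set x; y]
      * \sum_(P | pair_partition P (D :\: [set x; y])) \prod_(B in P) F B.
Proof.
move=> xD.
(* Each [P] contains exactly one pair [[set x; y]], so the inserted sum has a single term;
   exchanging the sums then groups the pairings by [y]. *)
transitivity (\sum_(P | pair_partition P D)
    \sum_(y in D :\ x | [set x; y] \in P) \prod_(B in P) F B).
  apply: eq_bigr => P /andP[partP /forall_inP card2].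
  have [covP tiP n0] := and3P partP.
  have xcov : x \in cover P by rewrite (eqP covP).
  have := card2 _ (pblock_mem xcov); rewrite (cardsD1 x) mem_pblock xcov eqSS.
  case/cards1P => y Ey.
  have Epx : pblock P x = [set x; y].
    by rewrite -[LHS](setD1K (a := x)) ?mem_pblock// Ey.
  have yx : y != x by have := set11 y; rewrite -Ey !inE => /andP[].
  have yD : y \in D.
    rewrite -(eqP covP); apply/bigcupP; exists (pblock P x); first exact: pblock_mem.
    by rewrite Epx !inE eqxx orbT.
  rewrite (big_pred1 y)// => z; rewrite !inE.
  apply/andP/eqP => [[/andP[zx zD] xzP]|->].
    have := def_pblock tiP xzP (set21 x z); rewrite Epx => /setP/(_ z).
    by rewrite !inE eqxx orbT (negbTE zx) => /eqP.
  by rewrite yx yD -Epx pblock_mem.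
rewrite (exchange_big_dep (fun y => y \in D :\ x))/=; last by move=> P y _ /andP[].
apply: eq_bigr => y; rewrite !inE => /andP[yx yD].
have xyD : [set x; y] \subset D by apply/subsetP => z; rewrite !inE => /orP[]/eqP->.
have xy2 : #|[set x; y]| = 2 by rewrite cards2 eq_sym yx.
rewrite big_distrr/=.
rewrite (reindex_onto (fun P => [set x; y] |: P) (fun P => P :\ [set x; y]))/=; last first.
  by move=> P /andP[_ /andP[_ ?]]; rewrite setD1K.
apply: eq_big => [P|P].
  apply/andP/idP => [[/andP[ppP _] /eqP <-]|ppP].
    by apply: pair_partition_setD => //; rewrite setU11.
  have [ppU nP] := pair_partition_setU xyD xy2 ppP.
  by rewrite ppU setU11 yx yD setU1K.
case/andP => /andP[ppP _] /eqP EP.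
by rewrite big_setU1//= -EP !inE eqxx.
Qed.

(** By [pair_partition_rec] the sum over pairings obeys the same recursion as [M], so strong
    induction on the size of [D] identifies the two. *)
Lemma wick_recursion (F M : {set T} -> A) D :
  M set0 = 1 ->
  (forall D x, x \in D ->
    M D = \sum_(y in D :\ x) F [set x; y] * M (D :\: [set x; y])) ->
  M D = \sum_(P | pair_partition P D) \prod_(B in P) F B.
Proof.
move=> M0 Mrec; have [n] := ubnP #|D|; elim: n D => // n IHn D Dn.
have [->|[x xD]] := set_0Vmem D.
  by rewrite M0 (big_pred1 set0) ?big_set0// => P; exact: pair_partition0.
rewrite (Mrec _ x)// (pair_partition_rec _ xD); apply: eq_bigr => y yD.
congr (_ * _); apply: IHn; rewrite -ltnS (leq_trans _ Dn)// ltnS.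
by rewrite proper_card// properEneq subsetDl andbT; apply/eqP => /setP/(_ x);
  rewrite !inE eqxx xD.
Qed.

End PairPartitions.

Lemma Rintegral_sum d (T : measurableType d) (R : realType)
    (mu : {measure set T -> \bar R}) (I : Type) (r : seq I) (f : I -> T -> R) :
  (forall i, mu.-integrable [set: T]%classic (EFin \o f i)) ->
  \int[mu]_x (\sum_(i <- r) f i x) = \sum_(i <- r) \int[mu]_x f i x.
Proof.
move=> intf; rewrite /Rintegral.
under eq_integral => x _ do rewrite -sumEFin.
rewrite (integral_sum measurableT intf).
under eq_bigr => i _ do rewrite -(fineK (integrable_fin_num measurableT (intf i))).
by rewrite sumEFin.
Qed.

(** * Wick's formula for independent Gaussian coordinates *)

Section GaussianWick.
Variable R : realType.
Notation mu := (@lebesgue_measure R).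

Definition gauss_moment (c : R) m : R :=
  (\int[mu]_x gauss_mono c m x) / \int[mu]_x gauss_weight c x.

Lemma Rintegral_gauss_mono0 (c : R) :
  \int[mu]_x gauss_mono c 0 x = \int[mu]_x gauss_weight c x.
Proof. by apply: eq_Rintegral => x _; rewrite /gauss_mono expr0 mul1r. Qed.

Lemma gauss_moment0 c : 0 < c -> gauss_moment c 0 = 1.
Proof.
move=> c0; rewrite /gauss_moment Rintegral_gauss_mono0 divff// gt_eqF//.
exact: Rintegral_gauss_weight_gt0.
Qed.

(** This is integration by parts divided by the total mass, [1 / (2 * c)] being the variance. At
    [m = 0] the factor 0 makes the mean vanish whatever [m.-1] is. *)
Lemma gauss_momentS c m : 0 < c ->
  gauss_moment c m.+1 = m%:R / (2 * c) * gauss_moment c m.-1.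
Proof.
move=> c0; have c20 : 2 * c != 0 by rewrite mulf_neq0 ?gt_eqF.
apply: (mulfI c20); rewrite /gauss_moment mulrA gauss_moment_rec// !mulrA.
by rewrite [2 * c * m%:R]mulrC mulfK.
Qed.

Variables (n : nat) (c : 'I_n -> R).
Hypothesis c_gt0 : forall i, 0 < c i.
Notation nu := (lebesgue_tuple R n).

Definition gauss_tuple_weight (t : n.-tuple R) : R :=
  \prod_i gauss_weight (c i) (tnth t i).

Section Monomials.
Variables (T : finType) (phi : T -> 'I_n).
Implicit Type D : {set T}.

(** The exponent of the coordinate [i] in the monomial [\prod_(x in D) tnth t (phi x)]. *)
Definition coord_count D i := #|[set x in D | phi x == i]|.

Definition gauss_tuple_moment D : R :=
  \prod_i gauss_moment (c i) (coord_count D i).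

Lemma prod_coord_weight D (t : n.-tuple R) :
  (\prod_(x in D) tnth t (phi x)) * gauss_tuple_weight t
  = \prod_i gauss_mono (c i) (coord_count D i) (tnth t i).
Proof.
rewrite (partition_big phi predT)//= -big_split/=; apply: eq_bigr => i _.
congr (_ * _); under eq_bigr => x /andP[_ /eqP->] do [].
rewrite -prodr_const; apply: eq_bigl => x.
by rewrite !inE.
Qed.

Lemma integrable_prod_coord D :
  nu.-integrable [set: n.-tuple R]%classic
    (fun t => ((\prod_(x in D) tnth t (phi x)) * gauss_tuple_weight t)%:E).
Proof.
under eq_fun do rewrite prod_coord_weight.
exact: (lebesgue_tuple_prod (fun i => integrable_gauss_mono _ (c_gt0 i))).1.
Qed.

Lemma Rintegral_gauss_tuple_weight :
  \int[nu]_t gauss_tuple_weight t = \prod_i \int[mu]_x gauss_weight (c i) x.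
Proof.
by rewrite /Rintegral (lebesgue_tuple_prod (fun i => integrable_gauss_weight (c_gt0 i))).2.
Qed.

Lemma Rintegral_prod_coord D :
  (\int[nu]_t ((\prod_(x in D) tnth t (phi x)) * gauss_tuple_weight t))
    / \int[nu]_t gauss_tuple_weight t
  = gauss_tuple_moment D.
Proof.
under eq_Rintegral do rewrite prod_coord_weight.
rewrite [X in X / _]/Rintegral.
rewrite (lebesgue_tuple_prod (fun i => integrable_gauss_mono _ (c_gt0 i))).2/=.
rewrite Rintegral_gauss_tuple_weight -prodfV -big_split.
by [].
Qed.

Lemma gauss_tuple_moment0 : gauss_tuple_moment set0 = 1.
Proof.
apply: big1 => i _; rewrite /coord_count (_ : [set _ in _ | _] = set0) ?cards0.
  exact: gauss_moment0.
by apply/setP => x; rewrite !inE.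
Qed.

(** Only the factor of the coordinate [phi x] is lowered. The integer in its recursion is the number
    of [y] in [D :\ x] with [phi y = phi x], and each such [y] contributes the same value. *)
Lemma gauss_tuple_moment_rec D x : x \in D ->
  gauss_tuple_moment D
  = \sum_(y in D :\ x) (phi x == phi y)%:R / (2 * c (phi x))
      * gauss_tuple_moment (D :\: [set x; y]).
Proof.
move=> xD; rewrite {1}/gauss_tuple_moment (bigD1 (phi x))//=.
set Q := \prod_(i < n | _) _.
have EQ y : y \in D :\ x -> phi x = phi y -> gauss_tuple_moment (D :\: [set x; y]) =
    gauss_moment (c (phi x)) (coord_count (D :\ x) (phi x)).-1 * Q.
  rewrite !inE => /andP[yx yD] xy.
  rewrite /gauss_tuple_moment (bigD1 (phi x))//=; congr (gauss_moment _ _ * _).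
    rewrite /coord_count [in RHS](cardsD1 y) !inE yx yD xy eqxx add1n /=.
    by apply: eq_card => z; rewrite !inE; case: (z == x); case: (z == y); rewrite ?andbF.
  apply: eq_bigr => i ix; congr (gauss_moment _ _); apply: eq_card => z.
  rewrite !inE; case: eqVneq => [->|_]; first by rewrite [phi x == i]eq_sym (negbTE ix) !andbF.
  by case: eqVneq => [->|//]; rewrite -xy [phi x == i]eq_sym (negbTE ix) !andbF.
have -> : coord_count D (phi x) = (coord_count (D :\ x) (phi x)).+1.
  rewrite /coord_count (cardsD1 x) !inE xD eqxx add1n; congr _.+1.
  by apply: eq_card => z; rewrite !inE andbA.
rewrite gauss_momentS//.
rewrite (eq_bigr (fun y => if phi x == phi y then (2 * c (phi x))^-1 * (gauss_moment
   (c (phi x)) (coord_count (D :\ x) (phi x)).-1 * Q) else 0)); last first.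
  by move=> y yD; case: eqP => [/(EQ _ yD) ->|_]; rewrite ?(mul1r,mul0r).
rewrite -big_mkcondr/= sumr_const -[RHS]mulr_natl.
have -> : #|[pred y | (y \in D :\ x) && (phi x == phi y)]| = coord_count (D :\ x) (phi x).
  by apply: eq_card => y; rewrite !inE [phi x == _]eq_sym.
by rewrite !mulrA.
Qed.

(** The moment recursion, with the signs [s] distributed over the pairs, has the form required by
    [wick_recursion]. The covariance [F] is a function of the unordered pair, so that it can be
    multiplied over blocks. *)
Lemma gauss_wick (s : T -> R) (F : {set T} -> R) D :
  (forall x y, x != y ->
    F [set x; y] = s x * s y * (phi x == phi y)%:R / (2 * c (phi x))) ->
  (\int[nu]_t ((\prod_(x in D) (s x * tnth t (phi x))) * gauss_tuple_weight t))
    / \int[nu]_t gauss_tuple_weight t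
  = \sum_(P | pair_partition P D) \prod_(B in P) F B.
Proof.
move=> FE; transitivity ((\prod_(x in D) s x) * gauss_tuple_moment D).
  under eq_Rintegral do rewrite big_split/= -mulrA.
  rewrite RintegralZl//; last exact: integrable_prod_coord.
  by rewrite -mulrA Rintegral_prod_coord.
apply: (wick_recursion (M := fun D => (\prod_(x in D) s x) * gauss_tuple_moment D)).
  by rewrite big_set0 mul1r gauss_tuple_moment0.
move=> {}D x xD; rewrite (gauss_tuple_moment_rec xD) mulr_sumr; apply: eq_bigr => y yD.
have yx : x != y by move: yD; rewrite !inE eq_sym => /andP[].
rewrite FE// (big_setD1 x)//= (big_setD1 y)//= setDDl.
by rewrite !mulrA; congr (_ * _); rewrite -!mulrA; congr (_ * (_ * _)); rewrite mulrC !mulrA.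
Qed.

End Monomials.

(** Linearity extends Wick's formula to a finite family of monomials; for the trace, the family is
    indexed by choices of units and of matrix indices. *)
Lemma gauss_wick_sum (T I : finType) (a : I -> R) (phi : I -> T -> 'I_n)
    (s : I -> T -> R) (F : I -> {set T} -> R) (D : {set T}) :
  (forall i x y, x != y -> F i [set x; y]
    = s i x * s i y * (phi i x == phi i y)%:R / (2 * c (phi i x))) ->
  (\int[nu]_t ((\sum_i a i * \prod_(x in D) (s i x * tnth t (phi i x)))
      * gauss_tuple_weight t)) / \int[nu]_t gauss_tuple_weight t
  = \sum_i a i * \sum_(P | pair_partition P D) \prod_(B in P) F i B.
Proof.
move=> FE.
pose mono i (t : n.-tuple R) :=
  (\prod_(x in D) (s i x * tnth t (phi i x))) * gauss_tuple_weight t.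
have imono (r : R) i : nu.-integrable [set: n.-tuple R]%classic (EFin \o (fun t => r * mono i t)).
  rewrite (_ : _ \o _ = (fun t => (r * \prod_(x in D) s i x)%:E
      * ((\prod_(x in D) tnth t (phi i x)) * gauss_tuple_weight t)%:E)%E).
    exact: (integrableZl measurableT _ (integrable_prod_coord (phi i) D)).
  by apply/funext => t; rewrite /mono /= big_split/= -EFinM !mulrA.
under eq_Rintegral => t _.
  rewrite mulr_suml; under eq_bigr => i _ do rewrite -mulrA -/(mono i t); over.
rewrite (Rintegral_sum _ (fun i => imono (a i) i)) mulr_suml; apply: eq_bigr => i _.
have imono1 : nu.-integrable [set: n.-tuple R]%classic (EFin \o mono i).
  by rewrite (_ : mono i = (fun t => 1 * mono i t)) ?imono//; apply/funext => t; rewrite mul1r.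
by rewrite RintegralZl// -mulrA -(gauss_wick D (FE i)).
Qed.

End GaussianWick.

(** * Words, bracketings and the expansion of the trace *)

Section WordSums.
Variables (I : finType) (V : nmodType).
Implicit Types (F G : seq I -> V) (q : seq I).

(** A nested sum rather than a sum over tuples, so that the recursions on matrix powers and on trees
    unfold by computation; [sum_words_ffun] converts to functions at the end. *)
Fixpoint sum_words n F : V :=
  if n is m.+1 then \sum_x sum_words m (fun q => F (x :: q)) else F [::].

Lemma eq_sum_words n F G : (forall q, size q = n -> F q = G q) ->
  sum_words n F = sum_words n G.
Proof.
elim: n F G => [|n IHn] F G FG /=; first exact: FG.
by apply: eq_bigr => x _; apply: IHn => q qn; apply: FG; rewrite /= qn.
Qed.

Lemma sum_wordsD n F G :
  sum_words n (fun q => F q + G q) = sum_words n F + sum_words n G.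
Proof.
elim: n F G => [//|n IHn] F G /=; rewrite -big_split/=.
by apply: eq_bigr => x _; rewrite IHn.
Qed.

Lemma sum_words_cat m n F :
  sum_words (m + n) F = sum_words m (fun q => sum_words n (fun q' => F (q ++ q'))).
Proof. by elim: m F => [//|m IHm] F /=; apply: eq_bigr => x _; rewrite IHm. Qed.

Lemma sum_words_rcons n F :
  sum_words n.+1 F = sum_words n (fun q => \sum_x F (rcons q x)).
Proof. by elim: n F => [//|n IHn] F /=; apply: eq_bigr => x _; exact: (IHn (fun q => F (x :: q))). Qed.

Lemma sum_words_tuple n F : sum_words n F = \sum_(t : n.-tuple I) F t.
Proof.
elim: n F => [|n IHn] F /=.
  by rewrite (big_pred1 [tuple]) // => t; apply/esym/eqP/val_inj; case: t => [[]].
under eq_bigr do rewrite IHn.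
rewrite pair_big/= (reindex (fun t : n.+1.-tuple I => (thead t, [tuple of behead t])))/=.
  by apply: eq_bigr => t _; rewrite [in RHS](tuple_eta t).
exists (fun u : I * n.-tuple I => [tuple of u.1 :: u.2]) => [t|[x t]] _.
  by rewrite /= -tuple_eta.
by rewrite /= theadE; congr pair; apply: val_inj.
Qed.

Lemma sum_words_ffun n F :
  sum_words n F = \sum_(f : {ffun 'I_n -> I}) F [seq f i | i <- enum 'I_n].
Proof.
rewrite sum_words_tuple (reindex (fun f : {ffun 'I_n -> I} => [tuple f i | i < n]))/=.
  by apply: eq_bigr => f _.
exists (fun t : n.-tuple I => [ffun i => tnth t i]) => [f|t] _.
  by apply/ffunP => i; rewrite ffunE tnth_mktuple.
by apply: eq_from_tnth => i; rewrite tnth_mktuple ffunE.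
Qed.

End WordSums.

Lemma raddf_sum_words (I : finType) (V W : nmodType) (h : V -> W) n (F : seq I -> V) :
  h 0 = 0 -> {morph h : x y / x + y} ->
  h (sum_words n F) = sum_words n (fun q => h (F q)).
Proof.
move=> h0 hD; elim: n F => [//|n IHn] F /=.
by rewrite (big_morph h hD h0); apply: eq_bigr => x _; exact: IHn.
Qed.

Section OctonionBilinear.
Variable F : fieldType.
Implicit Types x y z : octonion F.

Lemma oct_coordD x y i : oct_coord (x + y) i = oct_coord x i + oct_coord y i.
Proof. by rewrite /oct_coord mxE. Qed.

Lemma oct_coordZ (c : F) x i : oct_coord (c *: x) i = c * oct_coord x i.
Proof. by rewrite /oct_coord mxE. Qed.

Lemma oct_coord_mul x y c : oct_coord (oct_mul x y) c
  = \sum_(a < 8) \sum_(b < 8)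
      oct_coord x a * oct_coord y b * (oct_coef a.+1 b.+1 c.+1)%:~R.
Proof. exact: oct_coordE. Qed.

Lemma oct_mulDr x : {morph oct_mul x : y z / y + z}.
Proof.
move=> y z; apply: octP => i; rewrite oct_coordD !oct_coord_mul -big_split.
apply: eq_bigr => a _; rewrite -big_split; apply: eq_bigr => b _.
by rewrite oct_coordD mulrDr mulrDl.
Qed.

Lemma oct_mulDl y : {morph (fun x => oct_mul x y) : x z / x + z}.
Proof.
move=> x z; apply: octP => i; rewrite oct_coordD !oct_coord_mul -big_split.
apply: eq_bigr => a _; rewrite -big_split; apply: eq_bigr => b _.
by rewrite oct_coordD !mulrDl.
Qed.

Lemma oct_mulZr (c : F) x y : oct_mul x (c *: y) = c *: oct_mul x y.
Proof.
apply: octP => i; rewrite oct_coordZ !oct_coord_mul mulr_sumr.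
apply: eq_bigr => a _; rewrite mulr_sumr; apply: eq_bigr => b _.
by rewrite oct_coordZ mulrCA !mulrA.
Qed.

Lemma oct_mulZl (c : F) x y : oct_mul (c *: x) y = c *: oct_mul x y.
Proof.
apply: octP => i; rewrite oct_coordZ !oct_coord_mul mulr_sumr.
apply: eq_bigr => a _; rewrite mulr_sumr; apply: eq_bigr => b _.
by rewrite oct_coordZ !mulrA.
Qed.

Lemma oct_mul0r x : oct_mul x 0 = 0.
Proof. by rewrite -[in LHS](scale0r (0 : octonion F)) oct_mulZr scale0r. Qed.

Lemma oct_mul0l x : oct_mul 0 x = 0.
Proof. by rewrite -[in LHS](scale0r (0 : octonion F)) oct_mulZl scale0r. Qed.

Lemma oct_reD : {morph @oct_re F : x y / x + y}.
Proof. by move=> x y; exact: oct_coordD. Qed.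

Lemma oct_re0 : oct_re (0 : octonion F) = 0.
Proof. by rewrite /oct_re /oct_coord mxE. Qed.

Lemma oct_reZ (c : F) x : oct_re (c *: x) = c * oct_re x.
Proof. exact: oct_coordZ. Qed.

Lemma oct_unit_sum x : \sum_a oct_coord x a *: oct_unit F a = x.
Proof.
apply: octP => i; rewrite {1}/oct_coord summxE (bigD1 i)//= big1 ?addr0.
  by rewrite !mxE eqxx mulr1.
by move=> j ji; rewrite !mxE eq_sym (negbTE ji) mulr0.
Qed.

End OctonionBilinear.

(** * Fully nested bracketings and multilinear expansion *)

Section FullyNested.

Lemma cherries_gt0 t : (1 < leaves t)%N -> (0 < cherries t)%N.
Proof.
elim: t => // l IHl r IHr _ /=.
case: l IHl => [|l1 l2] IHl; case: r IHr => [|r1 r2] IHr //.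
- by rewrite add0n; apply: IHr; rewrite /= -addn1 leq_add ?leaves_gt0.
- by rewrite ltn_addr// IHl//= -addn1 leq_add ?leaves_gt0.
- by rewrite ltn_addr// IHl//= -addn1 leq_add ?leaves_gt0.
Qed.

(** If both children of the root were nodes, each would contain a cherry, so one child is a leaf. As
    [1 < n], the other child is a node: the root is then not a cherry, and the two families are
    disjoint. *)
Lemma fully_nested_bracketings n : (1 < n)%N ->
  perm_eq [seq t <- bracketings n.+1 | fully_nested t]
    ([seq Node Leaf t | t <- bracketings n & fully_nested t]
     ++ [seq Node t Leaf | t <- bracketings n & fully_nested t]).
Proof.
move=> n1; apply: uniq_perm.
- exact/filter_uniq/uniq_bracketings.
- rewrite cat_uniq !map_inj_uniq ?filter_uniq ?uniq_bracketings//=; [|by move=> ? ? []..].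
  rewrite andbT; apply/hasPn => _ /mapP[t _ ->]; apply/negP => /mapP[u].
  by rewrite mem_filter mem_bracketings => /andP[_ /eqP un] [_ uL]; rewrite -un -uL in n1.
move=> t; rewrite mem_cat mem_filter mem_bracketings.
apply/andP/orP => [[fnt /eqP tn]|].
  case: t fnt tn => [|l r]; first by case: n n1.
  case: l => [|l1 l2].
    rewrite /= add1n => fnr [rn]; left; apply/mapP; exists r => //.
    rewrite mem_filter mem_bracketings rn eqxx andbT.
    by case: r fnr rn => // _ rn; rewrite -rn in n1.
  have l1l : (1 < leaves (Node l1 l2))%N by rewrite /= -addn1 leq_add ?leaves_gt0.
  have := cherries_gt0 l1l.
  case: r => [|r1 r2].
    rewrite {1}/fully_nested /= addn0 addn1 => _ fnl [ln]; right; apply/mapP.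
    exists (Node l1 l2) => //.
    by rewrite mem_filter mem_bracketings /= ln eqxx andbT.
  have r1r : (1 < leaves (Node r1 r2))%N by rewrite /= -addn1 leq_add ?leaves_gt0.
  have := cherries_gt0 r1r; rewrite /fully_nested.
  have -> : cherries (Node (Node l1 l2) (Node r1 r2))
    = (cherries (Node l1 l2) + cherries (Node r1 r2))%N by [].
  by move=> a b /eqP; lia.
case=> /mapP[u]; rewrite mem_filter mem_bracketings => /andP[fnu /eqP un] ->.
  split; last by rewrite /= un.
  by case: u fnu un.
split; last by rewrite /= un addn1.
by case: u fnu un => //= *; rewrite /fully_nested /= addn0.
Qed.

Variable F : fieldType.
Notation fn := (fn_bracket (@oct_mul F)).

Lemma fn_bracket2 (x y : octonion F) : fn [:: x; y] = oct_mul x y.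
Proof.
rewrite /fn_bracket /bracketings /= /fully_nested big_cons big_nil /=.
by rewrite expr0 invr1 scale1r addr0.
Qed.

(** The outermost product splits off either the first or the last letter, and the factor 1/2 comes
    from the normalization [2 ^- (k - 2)]. This is the recursion of Jordan powers. *)
Lemma fn_bracket_rec (x y : octonion F) w : w != [::] ->
  fn (x :: rcons w y)
  = 2%:R^-1 *: (oct_mul x (fn (rcons w y)) + oct_mul (fn (x :: w)) y).
Proof.
case: w => [//|z w] _; rewrite /fn_bracket !size_rcons /= !size_rcons.
rewrite !subSS !subn0.
set n := size w.
rewrite -big_filter (perm_big _ (fully_nested_bracketings _))//= big_cat !big_map !big_filter.
rewrite oct_mulZr oct_mulZl -scalerDr scalerA -invfM -exprS.
congr (_ *: (_ + _)).
  rewrite (big_morph _ (oct_mulDr x) (oct_mul0r x)).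
  by apply: eq_bigr => t _ /=; rewrite ?drop0.
rewrite (big_morph _ (oct_mulDl y) (oct_mul0l y)).
(* Membership in [bracketings] fixes [leaves t], which places the cut of the word just before
   [y]. *)
rewrite big_seq_cond [RHS]big_seq_cond; apply: eq_bigr => t.
rewrite mem_bracketings => /andP[/eqP tn _] /=.
have E : x :: z :: rcons w y = (x :: z :: w) ++ [:: y] by rewrite -cats1.
by rewrite E take_size_cat ?drop_size_cat.
Qed.

Lemma bracket_value_expand t (l : seq (octonion F)) : size l = leaves t ->
  bracket_value 0 (@oct_mul F) t l
  = sum_words (size l) (fun g : seq 'I_8 => (\prod_(z <- zip l g) oct_coord z.1 z.2)
      *: bracket_value 0 (@oct_mul F) t [seq oct_unit F a | a <- g]).
Proof.
elim: t l => [|t1 IH1 t2 IH2] l.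
  case: l => [|x [|//]] //= _; rewrite -[LHS]oct_unit_sum.
  by apply: eq_bigr => a _; rewrite big_seq1.
move=> ln /=.
have st : size (take (leaves t1) l) = leaves t1.
  by rewrite size_takel// ln /= leq_addr.
have sd : size (drop (leaves t1) l) = leaves t2 by rewrite size_drop ln /= addKn.
rewrite IH1// IH2// st sd.
rewrite (raddf_sum_words (h := fun x => oct_mul x _) _ _ (oct_mul0l _) (oct_mulDl _)) ln sum_words_cat.
apply: eq_sum_words => g1 g1n.
rewrite (raddf_sum_words _ _ (oct_mul0r _) (oct_mulDr _)).
apply: eq_sum_words => g2 g2n.
rewrite oct_mulZl oct_mulZr scalerA; congr (_ *: oct_mul _ _).
- by rewrite -[in RHS](cat_take_drop (leaves t1) l) zip_cat ?big_cat// st.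
- by rewrite map_cat take_size_cat// size_map.
- by rewrite map_cat drop_size_cat// size_map.
Qed.

Lemma fn_bracket_expand (l : seq (octonion F)) :
  fn l = sum_words (size l) (fun g : seq 'I_8 => (\prod_(z <- zip l g) oct_coord z.1 z.2)
      *: fn [seq oct_unit F a | a <- g]).
Proof.
rewrite /fn_bracket big_seq_cond.
under eq_bigr => t /andP[].
  rewrite mem_bracketings => /eqP tl _; rewrite bracket_value_expand//; over.
rewrite -big_seq_cond.
transitivity (sum_words (size l) (fun g : seq 'I_8 => 2%:R ^- (size l - 2) *:
  \sum_(t <- bracketings (size l) | fully_nested t) ((\prod_(z <- zip l g) oct_coord z.1 z.2)
      *: bracket_value 0 (@oct_mul F) t [seq oct_unit F a | a <- g]))).
  rewrite -[RHS](raddf_sum_words (h := *:%R _)) ?scaler0//; last exact: scalerDr.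
  congr (_ *: _).
  elim: (bracketings _) => [|t s IHs].
    rewrite big_nil; under [RHS]eq_sum_words => q _ do rewrite big_nil.
    elim: (size l) => [//|n IHn] /=; rewrite big1// => i _; exact/esym.
  rewrite big_cons; under [RHS]eq_sum_words => q _ do rewrite big_cons.
  by case: ifP => _; rewrite ?sum_wordsD IHs.
apply: eq_sum_words => g gn; rewrite size_map gn -scaler_sumr !scalerA.
by rewrite mulrC.
Qed.

End FullyNested.

(** * The trace of a power as a sum over closed index paths *)

Section TraceExpansion.
Variable F : numFieldType.
Implicit Type X : 'M[octonion F]_3.
Notation fn := (fn_bracket (@oct_mul F)).

Lemma pairmap_rcons (T U : Type) (f : T -> T -> U) x s y :
  pairmap f x (rcons s y) = rcons (pairmap f x s) (f (last x s) y).
Proof. by rewrite -!cats1 pairmap_cat. Qed.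

(** The word consists of the entries of [X] along the path from [i] to [j] through [q]. Multiplying
    by [X] on the left or on the right extends the path at its start or at its end, in agreement
    with [fn_bracket_rec]. *)
Lemma jpow_expand X m i j :
  jpow X m.+2 i j
  = sum_words m.+1 (fun q : seq 'I_3 => fn (pairmap (fun a b => X a b) i (rcons q j))).
Proof.
have n2 : (2%:R : F) != 0 by rewrite pnatr_eq0.
elim: m i j => [|m IHm] i j.
  rewrite /jpow /= mxE -mulr2n -[X in _ *: X]scaler_nat scalerA mulVf// scale1r mxE.
  by apply: eq_bigr => l _ /=; rewrite fn_bracket2.
rewrite -[jpow X _]/(jordan X (jpow X m.+2)) mxE !mxE.
transitivity (sum_words m.+2 (fun q : seq 'I_3 => (2%:R : F)^-1 *:
  (oct_mul (X i (head i q)) (fn (pairmap (fun a b => X a b) (head i q) (rcons (behead q) j)))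
   + oct_mul (fn (pairmap (fun a b => X a b) i q)) (X (last i q) j)))); last first.
  apply: eq_sum_words => -[//|l q] [qn].
  rewrite /= pairmap_rcons -fn_bracket_rec ?pairmap_rcons//.
  by case: q qn.
rewrite -(raddf_sum_words (h := *:%R _)) ?scaler0//; last exact: scalerDr.
rewrite sum_wordsD; congr (_ *: (_ + _)).
  apply: eq_bigr => l _ /=; rewrite IHm.
  by rewrite (raddf_sum_words _ _ (oct_mul0r _) (oct_mulDr _)).
(* Multiplication on the right sums over the last intermediate index of the path, so the words are
   split at their end. *)
rewrite sum_words_rcons.
transitivity (\sum_l sum_words m.+1 (fun q : seq 'I_3 =>
    oct_mul (fn (pairmap (fun a b => X a b) i (rcons q l))) (X l j))).
  apply: eq_bigr => l _; rewrite IHm.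
  by rewrite (raddf_sum_words (h := fun x => oct_mul x _) _ _ (oct_mul0l _) (oct_mulDl _)).
have exch (V : nmodType) n (G : 'I_3 -> seq 'I_3 -> V) :
    \sum_l sum_words n (G l) = sum_words n (fun q => \sum_l G l q).
  elim: n G => [//|n IHn] G /=; rewrite exchange_big/=.
  by apply: eq_bigr => x _; rewrite IHn.
rewrite [LHS]exch; apply: eq_sum_words => q _.
by apply: eq_bigr => l _; rewrite last_rcons.
Qed.

(** [ordS] sends the last index to [ord0], so the final step of the closed path is the one from the
    last vertex to the appended first vertex. *)
Lemma pairmap_cycle (T U : Type) k (f : T -> T -> U) (p : 'I_k.+1 -> T) :
  let w := [seq p s | s <- enum 'I_k.+1] in
  pairmap f (head (p ord0) w) (rcons (behead w) (head (p ord0) w))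
  = [seq f (p s) (p (ordS s)) | s <- enum 'I_k.+1].
Proof.
set x0 := p ord0; move=> w; have wn : size w = k.+1 by rewrite size_map size_enum_ord.
have nw i (ik : (i < k.+1)%N) : nth x0 w i = p (Ordinal ik).
  rewrite (nth_map ord0) ?size_enum_ord//; congr p.
  by apply: val_inj; rewrite /= nth_enum_ord.
have w0 : head x0 w = x0 by rewrite -nth0 (nw 0%N (ltn0Sn k)); congr p; exact: val_inj.
have wE : x0 :: behead w = w by rewrite -{1}w0; case: (w) wn.
apply: (@eq_from_nth _ (f x0 x0)).
  by rewrite size_pairmap size_rcons size_behead wn size_map size_enum_ord.
rewrite size_pairmap size_rcons size_behead wn /= => i ik.
rewrite (nth_pairmap x0) ?size_rcons ?size_behead ?wn// w0.
rewrite -rcons_cons wE (nth_map ord0) ?size_enum_ord//.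
have -> : nth ord0 (enum 'I_k.+1) i = Ordinal ik by apply: val_inj; rewrite /= nth_enum_ord.
have -> z : nth x0 (rcons w z) i = p (Ordinal ik) by rewrite nth_rcons wn ik nw.
congr f.
rewrite nth_rcons size_behead wn /=.
have [ik'|ki|ik'] := ltngtP i k; [|by have := leq_trans ik ki; rewrite ltnn|].
  rewrite nth_behead nw; congr p; apply: val_inj => /=.
  by rewrite modn_small.
by congr p; apply: val_inj; rewrite /= ik' modnn.
Qed.

Lemma albert_tr_jpow X k : (1 < k)%N ->
  albert_tr (jpow X k)
  = \sum_(g : {ffun 'I_k -> 'I_8}) oct_re (fn (unit_word F g))
     * \sum_(p : {ffun 'I_k -> 'I_3})
         \prod_s oct_coord (X (p s) (p (ordS s))) (g s).
Proof.
case: k => [|[|m]]// _; rewrite /albert_tr.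
under eq_bigr => i _ do rewrite jpow_expand.
(* By conversion, the sum over the diagonal index becomes the sum over the first letter of a word of
   length [m.+2], read as a closed path. *)
rewrite -[X in oct_re X]/(sum_words m.+2 (fun q : seq 'I_3 =>
   fn (pairmap (fun a b => X a b) (head ord0 q) (rcons (behead q) (head ord0 q))))).
rewrite (raddf_sum_words _ _ (oct_re0 _) (@oct_reD _)) sum_words_ffun.
transitivity (\sum_(p : {ffun 'I_m.+2 -> 'I_3}) \sum_(g : {ffun 'I_m.+2 -> 'I_8})
   (\prod_s oct_coord (X (p s) (p (ordS s))) (g s)) * oct_re (fn (unit_word F g))).
  apply: eq_bigr => p _.
  have hE (x y : 'I_3) : head x [seq p i | i <- enum 'I_m.+2] = head y [seq p i | i <- enum 'I_m.+2].
    by rewrite enum_ordSl.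
  rewrite (hE ord0 (p ord0)) pairmap_cycle fn_bracket_expand.
  rewrite (raddf_sum_words _ _ (oct_re0 _) (@oct_reD _)) size_map size_enum_ord sum_words_ffun.
  apply: eq_bigr => g _; rewrite oct_reZ.
  congr (_ * oct_re (fn _)); last by rewrite -map_comp.
  by rewrite zip_map big_map big_enum.
rewrite exchange_big; apply: eq_bigr => g _.
by rewrite -mulr_suml mulrC.
Qed.

End TraceExpansion.

(** * The grading of the octonions *)

Section Grading.

(* For the indices a = 0, ..., 7 of the units, the oriented lines are triples
   whose bitwise sum vanishes, so that the binary digits of a grade the algebra. *)
Definition bits (a : nat) : bool * bool * bool := (odd a, odd a./2, odd a./2./2).

Definition add_bits (d e : bool * bool * bool) : bool * bool * bool :=
  (d.1.1 (+) e.1.1, d.1.2 (+) e.1.2, d.2 (+) e.2).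

Lemma add_bitsA : associative add_bits.
Proof. by move=> [[? ?] ?] [[? ?] ?] [[? ?] ?]; rewrite /add_bits /= !addbA. Qed.

Lemma add_0bits : left_id (bits 0) add_bits.
Proof. by move=> [[? ?] ?]. Qed.

Lemma oct_coef_bits (a b c : 'I_8) :
  bits c != add_bits (bits a) (bits b) -> oct_coef a.+1 b.+1 c.+1 = 0.
Proof.
have chk : all (fun a => all (fun b => all (fun c =>
    (bits c != add_bits (bits a) (bits b)) ==> (oct_coef a.+1 b.+1 c.+1 == 0))
    (iota 0 8)) (iota 0 8)) (iota 0 8) by vm_compute.
have io (i : 'I_8) : val i \in iota 0 8 by rewrite mem_iota ltn_ord.
move=> abc; apply/eqP; apply: implyP abc.
by have /allP/(_ _ (io a))/allP/(_ _ (io b))/allP/(_ _ (io c)) := chk.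
Qed.

Lemma bits_inj (a b : 'I_8) : bits a = bits b -> a = b.
Proof.
have chk : all (fun a => all (fun b => (bits a == bits b) ==> (a == b))
    (iota 0 8)) (iota 0 8) by vm_compute.
have io (i : 'I_8) : val i \in iota 0 8 by rewrite mem_iota ltn_ord.
move=> /eqP ab; apply/val_inj/eqP; apply: implyP ab.
by have /allP/(_ _ (io a))/allP/(_ _ (io b)) := chk.
Qed.

Variable F : fieldType.

Definition oct_homog d (x : octonion F) : Prop :=
  forall i : 'I_8, bits i != d -> oct_coord x i = 0.

Lemma oct_homog_unit (a : 'I_8) : oct_homog (bits a) (oct_unit F a).
Proof. by move=> i ia; rewrite oct_coordE; case: (i =P a) ia => [->|_ _]; rewrite ?eqxx. Qed.

Lemma oct_homogM d e x y :
  oct_homog d x -> oct_homog e y -> oct_homog (add_bits d e) (oct_mul x y).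
Proof.
move=> xd ye c cde; rewrite oct_coord_mul big1// => a _; apply: big1 => b _.
have [ad|/xd->] := eqVneq (bits a) d; last by rewrite !mul0r.
have [be|/ye->] := eqVneq (bits b) e; last by rewrite mulr0 mul0r.
by rewrite oct_coef_bits ?mulr0// ad be.
Qed.

Definition word_bits (g : seq 'I_8) := foldr (fun a : 'I_8 => add_bits (bits a)) (bits 0) g.

Lemma word_bits_cat g h : word_bits (g ++ h) = add_bits (word_bits g) (word_bits h).
Proof. by elim: g => [|a g IHg] /=; rewrite ?add_0bits// IHg add_bitsA. Qed.

(** Degrees add under multiplication and [add_bits] is associative, so the degree depends on the
    word and not on the bracketing. *)
Lemma bracket_homog t g : size g = leaves t ->
  oct_homog (word_bits g) (bracket_value 0 (@oct_mul F) t [seq oct_unit F a | a <- g]).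
Proof.
elim: t g => [|t1 IH1 t2 IH2] g.
  case: g => [|a [|//]] //= _.
  have -> : add_bits (bits a) (bits 0) = bits a by rewrite /add_bits !addbF; case: bits => [[]].
  exact: oct_homog_unit.
move=> gn; rewrite -{1}(cat_take_drop (leaves t1) g) word_bits_cat /= -map_take -map_drop.
apply: oct_homogM; [apply: IH1|apply: IH2].
  by rewrite size_takel// gn /= leq_addr.
by rewrite size_drop gn /= addKn.
Qed.

Lemma foldl_homog d x g : oct_homog d x ->
  oct_homog (add_bits d (word_bits g)) (foldl (@oct_mul F) x [seq oct_unit F a | a <- g]).
Proof.
elim: g d x => [|a g IHg] d x xd /=.
  have -> : add_bits d (bits 0) = d by rewrite /add_bits !addbF; case: d {xd} => [[]].
  by [].
by rewrite add_bitsA; apply: IHg; apply: oct_homogM xd _; exact: oct_homog_unit.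
Qed.

Lemma fn_bracket_homog g :
  oct_homog (word_bits g) (fn_bracket (@oct_mul F) [seq oct_unit F a | a <- g]).
Proof.
move=> i ig; rewrite /fn_bracket oct_coordZ size_map /oct_coord summxE big_seq_cond big1 ?mulr0//.
move=> t /andP[]; rewrite mem_bracketings => /eqP tn _.
exact: (bracket_homog (esym tn)).
Qed.

End Grading.

(** A nonzero imaginary coordinate of the product forces the degree of the word to differ from that
    of the real unit. Two fields occur because compatibility is tested over the rationals while the
    trace lives over the reals. *)
Lemma oct_re_fn_bracket_eq0 (F K : fieldType) (g : seq 'I_8) :
  ~~ oct_is_real (foldl (@oct_mul F) (oct_unit F ord0) [seq oct_unit F a | a <- g]) ->
  oct_re (fn_bracket (@oct_mul K) [seq oct_unit K a | a <- g]) = 0.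
Proof.
rewrite negb_forall => /existsP[i]; rewrite negb_imply => /andP[i0 gi].
apply: fn_bracket_homog; apply: contra i0 => /eqP g0; apply/eqP/bits_inj/eqP.
apply: contraR gi => gi; apply/eqP.
by apply: (@foldl_homog F _ _ g (@oct_homog_unit F ord0)); rewrite -g0.
Qed.

(** * Change of scalars, from rational to real octonions *)

Section OctonionMap.
Variables (F K : fieldType) (h : {rmorphism F -> K}).

Definition oct_map (x : octonion F) : octonion K := oct_mk (fun i => h (oct_coord x i)).

Lemma oct_map_unit a : oct_map (oct_unit F a) = oct_unit K a.
Proof. by apply: octP => i; rewrite !oct_coordE rmorph_nat. Qed.

Lemma oct_mapM x y : oct_map (oct_mul x y) = oct_mul (oct_map x) (oct_map y).
Proof.
apply: octP => i; rewrite oct_coord_mul oct_coordE oct_coord_mul rmorph_sum.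
apply: eq_bigr => a _; rewrite rmorph_sum; apply: eq_bigr => b _ /=.
by rewrite !rmorphM rmorph_int !oct_coordE.
Qed.

Lemma oct_mapD : {morph oct_map : x y / x + y}.
Proof. by move=> x y; apply: octP => i; rewrite oct_coordD !oct_coordE oct_coordD rmorphD. Qed.

Lemma oct_map0 : oct_map 0 = 0.
Proof. by apply: octP => i; rewrite oct_coordE /oct_coord !mxE rmorph0. Qed.

Lemma oct_mapZ c x : oct_map (c *: x) = h c *: oct_map x.
Proof. by apply: octP => i; rewrite oct_coordZ !oct_coordE oct_coordZ rmorphM. Qed.

Lemma bracket_value_oct_map t (w : seq (octonion F)) :
  bracket_value 0 (@oct_mul K) t (map oct_map w)
  = oct_map (bracket_value 0 (@oct_mul F) t w).
Proof.
elim: t w => [|t1 IH1 t2 IH2] w /=; first by case: w => [|x w] //=; rewrite oct_map0.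
by rewrite -map_take -map_drop IH1 IH2 oct_mapM.
Qed.

Lemma fn_bracket_oct_map (w : seq (octonion F)) :
  fn_bracket (@oct_mul K) (map oct_map w) = oct_map (fn_bracket (@oct_mul F) w).
Proof.
rewrite /fn_bracket size_map oct_mapZ fmorphV rmorphXn rmorph_nat; congr (_ *: _).
rewrite (big_morph _ oct_mapD oct_map0).
by apply: eq_bigr => t _; exact: bracket_value_oct_map.
Qed.

End OctonionMap.

Lemma oct_re_unit_word (F K : fieldType) (h : {rmorphism F -> K}) k (g : {ffun 'I_k -> 'I_8}) :
  oct_re (fn_bracket (@oct_mul K) (unit_word K g))
  = h (oct_re (fn_bracket (@oct_mul F) (unit_word F g))).
Proof.
have -> : unit_word K g = map (oct_map h) (unit_word F g).
  by rewrite /unit_word -map_comp; apply: eq_map => i /=; rewrite oct_map_unit.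
by rewrite fn_bracket_oct_map {1}/oct_re oct_coordE.
Qed.

(** * Colourings of the glued vertices *)

Section InvariantFunctions.
Variables (T A : finType) (e : rel T).
Hypothesis e_sym : symmetric e.

(** A function respecting [e] is constant on connected components, hence amounts to a free choice of
    a value for each class. *)
Lemma card_connect_invariant (a0 : A) :
  #|[pred p : {ffun T -> A} | [forall v, forall w, e v w ==> (p v == p w)]]|
  = (#|A| ^ #|equivalence_partition (connect e) [set: T]|)%N.
Proof.
set Pt := equivalence_partition _ _.
have eqv : {in [set: T] & &, equivalence_rel (connect e)}.
  move=> x y z _ _ _; split=> [|xy]; first exact: connect0.
  exact: same_connect (sym_connect_sym e_sym) _ _ xy _.
have partP : partition Pt [set: T] by exact: equivalence_partitionP.
have [covP tiP n0] := and3P partP.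
have pbE x y : (y \in pblock Pt x) = connect e x y.
  by apply: (pblock_equivalence_partition eqv); rewrite inE.
have pbP x : pblock Pt x \in Pt by apply: pblock_mem; rewrite (eqP covP).
(* Functions on the classes are encoded as functions on all sets with value a0
   outside the classes. *)
rewrite -(card_pffun_on a0 (mem Pt) (mem A)) -[RHS]cardsE.
pose Phi (q : {ffun {set T} -> A}) : {ffun T -> A} := [ffun v => q (pblock Pt v)].
rewrite -(card_in_imset (f := Phi)).
  apply: eq_card => p; rewrite !inE; apply/forallP/imsetP => [pinv|[q _ ->] v].
    have pcon v w : connect e v w -> p v = p w.
      case/connectP => s; elim: s v => [|u s IHs] v /=; first by move=> _ ->.
      case/andP => vu us wE; rewrite -(IHs _ us wE).
      exact/eqP/(implyP (forallP (pinv v) u)).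
    exists [ffun B : {set T} => if B \in Pt then oapp p a0 [pick v in B] else a0].
      rewrite inE; apply/pffun_onP; split=> //.
      by apply/supportP => B BP; rewrite ffunE (negbTE BP).
    apply/ffunP => v; rewrite !ffunE pbP; case: pickP => [w /=|/(_ v)].
      by rewrite pbE => /pcon.
    by rewrite /= pbE connect0.
  apply/forallP => w; apply/implyP => vw; rewrite !ffunE; apply/eqP; congr (q _).
  by apply: same_pblock => //; rewrite pbE (sym_connect_sym e_sym) connect1.
move=> q1 q2; rewrite !inE => /pffun_onP[/supportP s1 _] /pffun_onP[/supportP s2 _] /ffunP q12.
apply/ffunP => B; have [BP|BP] := boolP (B \in Pt); last by rewrite s1// s2.
have /set0Pn[v vB] : B != set0 by apply: contraNneq n0 => <-.
by have := q12 v; rewrite !ffunE (def_pblock tiP BP vB).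
Qed.

End InvariantFunctions.

Section GluingVertices.
Variable k : nat.
Implicit Types (pi : gluing k) (B : {set 'I_k}) (p : {ffun 'I_k -> 'I_3}).

Definition twist_match p B : bool :=
  [forall x in B, forall y in B, (p x == p y) && (p (ordS x) == p (ordS y))].

(** Both orders of a pair are quantified over, so the single equation gives both identifications of
    a start with an end; [x != y] keeps an edge from being compared with itself. *)
Definition straight_match p B : bool :=
  [forall x in B, forall y in B, (x != y) ==> (p x == p (ordS y))].

Lemma twist_match2 p x y :
  twist_match p [set x; y] = (p x == p y) && (p (ordS x) == p (ordS y)).
Proof.
apply/forall_inP/idP => [/(_ x (set21 x y))/forall_inP/(_ y (set22 x y))//|].
move=> /andP[/eqP xy /eqP xy'] u; rewrite !inE => u2; apply/forall_inP => v; rewrite !inE.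
by case/orP: u2 => /eqP->; case/orP => /eqP->; rewrite ?xy ?xy' !eqxx.
Qed.

Lemma straight_match2 p x y : x != y ->
  straight_match p [set x; y] = (p x == p (ordS y)) && (p (ordS x) == p y).
Proof.
move=> nxy; apply/forall_inP/andP => [H|[/eqP xy /eqP xy'] u].
  have /forall_inP/(_ y (set22 x y))/implyP/(_ nxy) -> := H x (set21 x y).
  have /forall_inP/(_ x (set21 x y))/implyP := H y (set22 x y).
  by rewrite eq_sym nxy => /(_ isT); rewrite eq_sym => ->.
rewrite !inE => u2; apply/forall_inP => v; rewrite !inE.
by case/orP: u2 => /eqP->; case/orP => /eqP->; rewrite ?eqxx// ?xy ?xy' ?eqxx ?implybT.
Qed.

Lemma glued_vertices_invariant p pi : [forall B in pi.1, #|B| == 2] ->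
  [forall v, forall w, glued_vertices pi v w ==> (p v == p w)]
  = [forall B in pi.1, if B \in pi.2 then twist_match p B else straight_match p B].
Proof.
move=> /forall_inP card2; apply/forallP/forall_inP => [H B BP|H v].
  have /cards2P[x [y [nxy BE]]] := card2 _ BP.
  have inv v w : glued_vertices pi v w -> p v == p w.
    exact: (implyP (forallP (H v) w)).
  rewrite BE twist_match2 straight_match2// -BE.
  have g v w : (if B \in pi.2
    then (v == x) && (w == y) || (v == ordS x) && (w == ordS y)
    else (v == x) && (w == ordS y) || (v == ordS x) && (w == y)) -> p v == p w.
    by move=> h; apply: inv; apply/existsP; exists x; apply/existsP; exists y; rewrite nxy -BE BP.
  by move: g; case: ifP => _ g; apply/andP; split; apply: g; rewrite !eqxx ?orbT.
apply/forallP => w; apply/implyP => /existsP[x /existsP[y /and3P[nxy xyP]]].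
have := H _ xyP; rewrite twist_match2 straight_match2//.
by case: ifP => _ /andP[h h'] /orP[] /andP[/eqP-> /eqP->].
Qed.

Lemma card_gluing_match pi : [forall B in pi.1, #|B| == 2] ->
  #|[pred p : {ffun 'I_k -> 'I_3} |
     [forall B in pi.1, if B \in pi.2 then twist_match p B else straight_match p B]]|
  = (3 ^ gluing_N pi)%N.
Proof.
move=> card2; rewrite -[X in (X ^ _)%N]card_ord.
rewrite -(card_connect_invariant (@glued_vertices_sym k pi) ord0).
by apply: eq_card => p; rewrite !inE glued_vertices_invariant.
Qed.

End GluingVertices.

(** * Covariances of the coordinates *)

Section PairCovariance.
Variable R : realFieldType.

(* Up to the sign [slot_sign], which is 0 for an imaginary diagonal entry, the
   coordinate of index a of the entry (i, j) is the coordinate [slot i j a] of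
   the underlying 27-tuple. *)
Definition slot (i j a : nat) : nat :=
  if i == j then i else (3 + 8 * (i + j).-1 + a)%N.

Definition slot_sign (i j a : nat) : int :=
  if i == j then (a == 0)%N%:R else if (i < j)%N || (a == 0)%N then 1 else -1.

Lemma slot_lt27 (i j : 'I_3) (a : 'I_8) : (slot i j a < 27)%N.
Proof.
have ij : (i : nat) == j \/ ((i + j).-1 < 3)%N.
  by case: i j => [[|[|[|m]]] hi] [[|[|[|n]]] hj] //=; by [left|right].
rewrite /slot; case: eqP => [_|]; first exact: leq_trans (ltn_ord i) _.
by move=> /eqP/negbTE ne; case: ij; rewrite ?ne//; have := ltn_ord a; lia.
Qed.

Lemma oct_coord_albert_mx (v : 27.-tuple R) (i j : 'I_3) (a : 'I_8) :
  oct_coord (albert_mx v i j) a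
  = (slot_sign i j a)%:~R * tnth v (inord (slot i j a)).
Proof.
rewrite (tnth_nth 0) inordK ?slot_lt27// mxE /slot /slot_sign (inj_eq val_inj).
have a0 : (a == ord0) = (val a == 0)%N by [].
case: eqVneq => [_|nij]; first by rewrite oct_coordZ oct_coordE a0 mulrC; case: eqP.
case: (ltngtP i j) nij => [ij _|ij _|/val_inj->] //=; last by rewrite eqxx.
  by rewrite oct_coordE mul1r.
by rewrite oct_coordE a0; case: ifP => _; rewrite oct_coordE ?mul1r// mulN1r.
Qed.

(** The factor 2 or 1 is twice the variance of the coordinate, 1 on the diagonal and 1/2 off it.
    Clearing this denominator leaves an integer identity with finitely many cases, which computation
    checks. *)
Lemma slot_covariance (i j l m : 'I_3) (a b : 'I_8) :
  slot_sign i j a * slot_sign l m b * (slot i j a == slot l m b)%:R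
    * (if i == j then 2 else 1)
  = (a == b)%:R * (((i == l) && (j == m))%:R
      + (if a == ord0 then 1 else -1) * ((i == m) && (j == l))%:R).
Proof.
pose t := iota 0 3; pose o := iota 0 8.
have chk : all (fun i => all (fun j => all (fun l => all (fun m =>
   all (fun a => all (fun b =>
  slot_sign i j a * slot_sign l m b * (slot i j a == slot l m b)%:R
    * (if i == j then 2 else 1)
  == (a == b)%:R * (((i == l) && (j == m))%:R
      + (if a == 0%N then 1 else -1) * ((i == m) && (j == l))%:R)) o) o) t) t) t) t.
  by vm_compute.
have it (x : 'I_3) : val x \in t by rewrite mem_iota ltn_ord.
have io (x : 'I_8) : val x \in o by rewrite mem_iota ltn_ord.
by have /allP/(_ _ (it i))/allP/(_ _ (it j))/allP/(_ _ (it l))/allP/(_ _ (it m))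
  /allP/(_ _ (io a))/allP/(_ _ (io b))/eqP := chk.
Qed.

Variable k : nat.
Implicit Types (g : {ffun 'I_k -> 'I_8}) (p : {ffun 'I_k -> 'I_3}) (B : {set 'I_k}).

Definition unit_const g B : bool := [forall i in B, forall j in B, g i == g j].

(** The factor of [gluing_alpha] for a block glued without a twist. *)
Definition straight_sign g B : R := if [forall i in B, g i == ord0] then 1 else -1.

Definition pair_covariance g p B : R :=
  (unit_const g B)%:R * (2^-1 * ((twist_match p B)%:R
    + straight_sign g B * (straight_match p B)%:R)).

Definition edge_coord g p (x : 'I_k) : 'I_27 := inord (slot (p x) (p (ordS x)) (g x)).

Definition edge_sign g p (x : 'I_k) : R := (slot_sign (p x) (p (ordS x)) (g x))%:~R.

(* [Tr (X^2) / 2] is the sum of [coord_rate m * v_m ^+ 2]. *)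
Definition coord_rate (m : 'I_27) : R := if (m < 3)%N then 2^-1 else 1.

Lemma pair_covarianceE g p x y : x != y ->
  pair_covariance g p [set x; y]
  = edge_sign g p x * edge_sign g p y * (edge_coord g p x == edge_coord g p y)%:R
    / (2 * coord_rate (edge_coord g p x)).
Proof.
move=> nxy.
have gc : unit_const g [set x; y] = (g x == g y).
  apply/forall_inP/eqP => [/(_ x (set21 x y))/forall_inP/(_ y (set22 x y))/eqP//|gxy u].
  rewrite !inE => u2; apply/forall_inP => w; rewrite !inE.
  by case/orP: u2 => /eqP->; case/orP => /eqP->; rewrite ?gxy.
have sE : g x = g y -> [forall i in [set x; y], g i == ord0] = (g x == ord0).
  move=> gxy; apply/forall_inP/idP => [/(_ x (set21 x y))//|gx0 u].
  by rewrite !inE => /orP[]/eqP->; rewrite -?gxy.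
rewrite /pair_covariance gc twist_match2 straight_match2// /straight_sign.
have -> : (edge_coord g p x == edge_coord g p y)
    = (slot (p x) (p (ordS x)) (g x) == slot (p y) (p (ordS y)) (g y)).
  by rewrite -(inj_eq val_inj) /= !inordK ?slot_lt27.
(* The inverse of twice the rate is the variance, here matched with the diagonal factor of
   [slot_covariance]. *)
have rE : (2 * coord_rate (edge_coord g p x))^-1
    = 2^-1 * (if p x == p (ordS x) then 2 else 1)%:~R.
  rewrite /coord_rate /edge_coord inordK ?slot_lt27// /slot (inj_eq val_inj).
  case: (p x == p (ordS x)); first by rewrite ltn_ord divff ?invr1 ?mulVf ?pnatr_eq0.
  by rewrite -addnA ltnNge leq_addr mulr1 mulr1.
have := congr1 (fun z : int => z%:~R : R)
  (slot_covariance (p x) (p (ordS x)) (p y) (p (ordS y)) (g x) (g y)).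
rewrite /edge_sign rE; set s1 := slot_sign _ _ _; set s2 := slot_sign _ _ _.
rewrite !(rmorphM, rmorphD) /= ![(_ : bool)%:R%:~R]rmorph_nat => E.
rewrite mulrCA [RHS]mulrCA; congr (_ * _); rewrite E.
case: eqP => [gxy|_]; last by rewrite !mul0r.
by rewrite sE//; case: ifP; rewrite ?rmorphN rmorph1.
Qed.

End PairCovariance.

Section AlbertNorm.
Variable R : realFieldType.

Lemma oct_re_mul_conj (x : octonion R) :
  oct_re (oct_mul x (oct_conj x)) = \sum_a oct_coord x a ^+ 2.
Proof.
have io (a : 'I_8) : val a \in iota 0 8 by rewrite mem_iota ltn_ord.
have chk : all (fun a => all (fun b =>
    oct_coef a.+1 b.+1 1 == if a == b then if a == 0%N then 1 else -1 else 0)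
    (iota 0 8)) (iota 0 8) by vm_compute.
have coefE (a b : 'I_8) : oct_coef a.+1 b.+1 1
    = if a == b then if a == ord0 then 1 else -1 else 0.
  by have /allP/(_ _ (io a))/allP/(_ _ (io b))/eqP := chk.
rewrite /oct_re oct_coord_mul; apply: eq_bigr => a _.
rewrite (bigD1 a)//= big1 ?addr0 => [|b ba]; last first.
  by rewrite coefE eq_sym (negbTE ba) mulr0.
rewrite coefE eqxx oct_coordE; case: eqP => _; first by rewrite mulr1.
by rewrite rmorphN1 mulrN1 mulrN opprK.
Qed.

(** As [X] is Hermitian, the trace of its square is the sum of the squared norms of all nine
    entries, and each off-diagonal octonion occurs twice. *)
Lemma albert_tr_sqr (v : 27.-tuple R) :
  albert_tr (jpow (albert_mx v) 2) = \sum_m 2 * coord_rate R m * tnth v m ^+ 2.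
Proof.
set X := albert_mx v; pose f m : R := v`_m ^+ 2.
pose S q : R := \sum_(a < 8) f (3 + 8 * q + a)%N.
have XE (i l : 'I_3) : \sum_a oct_coord (X i l) a ^+ 2
    = if i == l then f i else S (i + l).-1.
  rewrite /S; case: eqVneq => [<-|il].
    rewrite (bigD1 ord0)//= big1 ?addr0 => [|a a0]; last first.
      by rewrite oct_coord_albert_mx /slot_sign eqxx (_ : _ == _ = false) ?mul0r ?expr0n//; exact/negbTE.
    by rewrite oct_coord_albert_mx /slot_sign /slot !eqxx mul1r (tnth_nth 0) inordK// (leq_trans (ltn_ord i)).
  apply: eq_bigr => a _; rewrite oct_coord_albert_mx exprMn (tnth_nth 0) inordK ?slot_lt27//.
  rewrite /slot_sign /slot !(inj_eq val_inj) (negbTE il).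
  by case: ifP => _; rewrite ?rmorphN1 ?sqrrN expr1n mul1r.
have -> : albert_tr (jpow X 2) = \sum_i \sum_l \sum_a oct_coord (X i l) a ^+ 2.
  rewrite /albert_tr (big_morph _ (@oct_reD _) (@oct_re0 _)); apply: eq_bigr => i _.
  rewrite jpow_expand /= (big_morph _ (@oct_reD _) (@oct_re0 _)); apply: eq_bigr => l _.
  by rewrite /= fn_bracket2 (albert_mx_hermitian v i l) oct_re_mul_conj.
under eq_bigr => i _ do under eq_bigr => l _ do rewrite XE.
have -> : \sum_m 2 * coord_rate R m * tnth v m ^+ 2
    = \sum_(m < 3 + (8 + (8 + 8))) (if (m < 3)%N then 1 else 2) * f m.
  apply: eq_bigr => m _; rewrite (tnth_nth 0) /coord_rate; case: ifP => _; rewrite ?mulr1//.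
  by rewrite divff// pnatr_eq0.
rewrite !big_split_ord/=.
have SE (q : nat) (h : 'I_8 -> nat) : (forall a, h a = (3 + 8 * q + a)%N) ->
    \sum_(a < 8) (if (h a < 3)%N then 1 else 2) * f (h a) = 2 * S q.
  move=> hE; rewrite /S mulr_sumr; apply: eq_bigr => a _; rewrite hE.
  by rewrite -addnA ltnNge leq_addr.
rewrite (SE 0%N (fun a => 3 + a)%N)// (SE 1%N (fun a => 3 + (8 + a))%N); last by move=> a; lia.
rewrite (SE 2%N (fun a => 3 + (8 + (8 + a)))%N); last by move=> a; lia.
rewrite !big_ord_recl !big_ord0 /= !mul1r !addr0 /bump /=.
ring.
Qed.

End AlbertNorm.

(** * The mean of the trace *)

Section BigopComplements.

Lemma prodrD_subset (A : comPzRingType) (I : finType) (P : {set I}) (x y : I -> A) :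
  \prod_(i in P) (x i + y i)
  = \sum_(J : {set I} | J \subset P) \prod_(i in P) (if i \in J then x i else y i).
Proof.
(* Outside [P] the summands become 0 and 1, so in the full distributive expansion only the subsets
   of [P] survive. *)
pose x' i := if i \in P then x i else 0; pose y' i := if i \in P then y i else 1.
have -> : \prod_(i in P) (x i + y i) = \prod_i (x' i + y' i).
  rewrite big_mkcond; apply: eq_bigr => i _; rewrite /x' /y'.
  by case: (i \in P); rewrite ?add0r.
rewrite bigA_distr (bigID (fun J : {set I} => J \subset P))/= [X in _ + X]big1 ?addr0.
  apply: eq_big => [//|J JP].
  rewrite [RHS]big_mkcond; apply: eq_bigr => i _; rewrite /x' /y'.
  have [//|iP] := boolP (i \in P).
  by rewrite ifF//; apply/negP => /(fintype.subsetP JP); rewrite (negbTE iP).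
move=> J /subsetPn[i iJ iP].
by rewrite (bigD1 i)//= iJ /x' (negbTE iP) mul0r.
Qed.

Lemma prodr_nat_forall (A : comPzRingType) (I : finType) (P : {set I}) (b : I -> bool) :
  \prod_(i in P) (b i)%:R = [forall i in P, b i]%:R :> A.
Proof.
have [/forall_inP h|] := boolP [forall i in P, b i].
  by apply: big1 => i iP; rewrite h.
rewrite negb_forall => /existsP[i]; rewrite negb_imply => /andP[iP ib].
by rewrite (bigD1 i)//= (negbTE ib) mul0r.
Qed.

End BigopComplements.

Section SumOverIndices.
Variables (R : realType) (k : nat).
Implicit Types (g : {ffun 'I_k -> 'I_8}) (P Q : {set {set 'I_k}}).

Lemma card_pair_partition P : pair_partition P [set: 'I_k] -> #|P| = k./2.
Proof.
case/andP => partP /forall_inP card2.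
have := card_uniform_partition (n := 2) (fun B BP => eqP (card2 B BP)) partP.
by rewrite cardsT card_ord muln2 => ke; rewrite [in RHS]ke doubleK.
Qed.

(** In the expansion over blocks, [Q] collects the pairs for which the twisted term is chosen. The
    straight terms produce the sign [gluing_alpha], and summing the remaining indicator over [p]
    counts the 3-colourings of the glued vertices. *)
Lemma sum_pair_covariance g P : pair_partition P [set: 'I_k] ->
  \sum_(p : {ffun 'I_k -> 'I_3}) \prod_(B in P) pair_covariance R g p B
  = 2 ^- k./2 * \sum_(Q : {set {set 'I_k}} | Q \subset P)
      [forall B in P, unit_const g B]%:R
      * (ratr (gluing_alpha (P, Q) g) * 3 ^+ gluing_N (P, Q)).
Proof.
move=> ppP; rewrite -exprVn -(card_pair_partition ppP) mulr_sumr.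
have card2 : [forall B in P, #|B| == 2] by case/andP: ppP.
pose m Q p B := if B \in Q then twist_match p B else straight_match p B.
transitivity (\sum_(p : {ffun 'I_k -> 'I_3}) \sum_(Q : {set {set 'I_k}} | Q \subset P)
   (2^-1 ^+ #|P| * ([forall B in P, unit_const g B]%:R * (ratr (gluing_alpha (P, Q) g)
      * [forall B in P, m Q p B]%:R))) : R).
  apply: eq_bigr => p _; rewrite /pair_covariance !big_split/= prodr_nat_forall prodr_const.
  rewrite prodrD_subset !mulr_sumr; apply: eq_bigr => Q QP.
  rewrite mulrCA; congr (_ * (_ * _)).
  rewrite -prodr_nat_forall rmorph_prod -big_split; apply: eq_bigr => B BP /=.
  rewrite /m /straight_sign; case: ifP => BQ; case: ifP => _;
    by rewrite ?rmorphN ?rmorph1 ?mul1r.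
rewrite exchange_big; apply: eq_bigr => Q QP /=.
rewrite -!mulr_sumr; congr (_ * (_ * (_ * _))).
rewrite -natrX -(@card_gluing_match k (P, Q) card2) -sum1_card natr_sum [RHS]big_mkcond/=.
by apply: eq_bigr => p _; rewrite unfold_in /=; case: ifP.
Qed.

End SumOverIndices.

Section AlbertMean.
Variables (R : realType) (k : nat).
Implicit Types (g : {ffun 'I_k -> 'I_8}) (p : {ffun 'I_k -> 'I_3}).
Notation fn := (fn_bracket (@oct_mul R)).

Lemma coord_rate_gt0 m : 0 < coord_rate R m.
Proof. by rewrite /coord_rate; case: ifP. Qed.

Lemma albert_weightE (v : 27.-tuple R) :
  expR (- (albert_tr (jpow (albert_mx v) 2) / 2%:R)) = gauss_tuple_weight (coord_rate R) v.
Proof.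
rewrite /gauss_tuple_weight /gauss_weight -expR_sum albert_tr_sqr sumrN; congr (expR (- _)).
rewrite mulr_suml; apply: eq_bigr => m _.
by rewrite -!mulrA mulrC !mulrA divfK ?pnatr_eq0// mulrC.
Qed.

Lemma albert_mean_tr_jpow : (1 < k)%N ->
  albert_mean (fun X : 'M[octonion R]_3 => albert_tr (jpow X k))
  = \sum_g oct_re (fn (unit_word R g))
      * \sum_p \sum_(P | pair_partition P [set: 'I_k])
          \prod_(B in P) pair_covariance R g p B.
Proof.
move=> k1; rewrite /albert_mean.
under [X in _ / X]eq_Rintegral => v _ do rewrite albert_weightE.
(* The pairs [(g, p)] index one family of monomials, so a single use of Wick's formula covers the
   whole trace. *)
have wick := @gauss_wick_sum R 27 (coord_rate R) coord_rate_gt0 _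
  ({ffun 'I_k -> 'I_8} * {ffun 'I_k -> 'I_3})%type
  (fun gp => oct_re (fn (unit_word R gp.1)))
  (fun gp => edge_coord gp.1 gp.2) (fun gp => edge_sign R gp.1 gp.2)
  (fun gp => pair_covariance R gp.1 gp.2) [set: 'I_k]
  (fun gp x y => @pair_covarianceE R k gp.1 gp.2 x y).
rewrite [RHS](_ : _ = \sum_(gp : {ffun 'I_k -> 'I_8} * {ffun 'I_k -> 'I_3})
    oct_re (fn (unit_word R gp.1)) * \sum_(P | pair_partition P [set: 'I_k])
      \prod_(B in P) pair_covariance R gp.1 gp.2 B); last first.
  by under eq_bigr do rewrite mulr_sumr; rewrite pair_bigA.
rewrite -wick; congr (_ / _); apply: eq_Rintegral => v _.
rewrite albert_weightE albert_tr_jpow//; congr (_ * _).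
under eq_bigr do rewrite mulr_sumr; rewrite pair_bigA; apply: eq_bigr => -[g p] _ /=.
congr (_ * _); apply: eq_big => [x|x _]; first by rewrite inE.
exact: oct_coord_albert_mx.
Qed.

End AlbertMean.

Theorem theorem3p7 (R : realType) (k : nat) (k_ge2 : (2 <= k)%N)
    (k_even : ~~ odd k) :
  albert_mean (fun X : 'M[octonion R]_3 => albert_tr (jpow X k))
  = 2%:R ^- k./2 *
    \sum_(pi in oriented_gluings k)
      \sum_(f : {ffun 'I_k -> 'I_8} | compatible pi f)
        ratr (gluing_Omega pi f) * 3%:R ^+ gluing_N pi.
Proof.
rewrite albert_mean_tr_jpow//.
(* Compatibility moves into the summand so that the sums can be exchanged and compared for each [f]
   separately. *)
transitivity (\sum_(f : {ffun 'I_k -> 'I_8}) 2%:R ^- k./2 *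
  \sum_(pi in oriented_gluings k)
    if compatible pi f then ratr (gluing_Omega pi f) * 3%:R ^+ gluing_N pi else 0 : R);
  last first.
  rewrite -mulr_sumr exchange_big/=; congr (_ * _); apply: eq_bigr => pi _.
  by rewrite -big_mkcond.
apply: eq_bigr => f _; rewrite exchange_big/=.
under eq_bigr => P ppP do rewrite sum_pair_covariance//.
rewrite -mulr_sumr mulrCA; congr (_ * _); rewrite mulr_sumr.
transitivity (\sum_(P | pair_partition P [set: 'I_k]) \sum_(Q : {set {set 'I_k}} | Q \subset P)
   if compatible (P, Q) f then ratr (gluing_Omega (P, Q) f) * 3%:R ^+ gluing_N (P, Q) else 0 : R).
  apply: eq_bigr => P _; rewrite mulr_sumr; apply: eq_bigr => Q _.
  rewrite /compatible /gluing_Omega -/(unit_const f) (oct_re_unit_word (@ratr R)) rmorphM /=.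
  (* An incompatible [f] contributes nothing: either the product is not real and the bracket has
     real part 0, or some pair carries two different units and its covariance is 0. *)
  case: ifP => [/andP[_ H]|/negbT].
    by rewrite (_ : [forall B in P, unit_const f B])// mul1r mulrA [X in X * _]mulrC.
  rewrite negb_and => /orP[nreal|nconst].
    rewrite -(oct_re_unit_word (@ratr R)).
    have -> : oct_re (fn_bracket (@oct_mul R) (unit_word R f)) = 0.
      have wordE (K : fieldType) :
          unit_word K f = [seq oct_unit K a | a <- [seq f i | i <- enum 'I_k]].
        by rewrite -map_comp.
      by rewrite wordE; apply: (@oct_re_fn_bracket_eq0 rat); rewrite -wordE.
    by rewrite mul0r.
  by rewrite (_ : [forall B in P, unit_const f B] = false) ?mul0r ?mulr0//; exact/negbTE.
(* The pairs of a pairing [P] and a subset [Q] of its blocks are exactly the oriented gluings. *)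
rewrite pair_big_dep/=; apply: eq_big => [[P Q]|[P Q] _] //=.
by rewrite oriented_gluingsE.
Qed.
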